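(* Assume the Parameterized Inapproximability Hypothesis. Then there is a universal constant $c>0$ such that it is \textsf{W[1]}-hard, when parameterized by the number $k$ of vectors to be selected, to approximate \textsc{Determinant Maximization} within a factor of $2^{-c\sqrt{k}}$. Moreover, the same hardness holds even if all diagonal entries of the input matrix are equal to $1$.
   Context: \textsc{Determinant Maximization}: given a positive semi-definite matrix $\mathbf{A}\in\mathbb{Q}^{n\times n}$ and $k\in[n]$, maximize $\det(\mathbf{A}_S)$ over $S\subseteq[n]$ with $|S|=k$ ($\mathbf{A}_S$ the principal submatrix indexed by $S$). Binary Constraint Satisfaction Problem (BCSP): given variables $V=[k]$, alphabet $\Sigma=[n]$, and for each pair of distinct variables $i,j$ a constraint $C_{i,j}=C_{j,i}\subseteq\Sigma^2$, an assignment $\psi:V\to\Sigma$ satisfies $C_{i,j}$ if $(\psi(i),\psi(j))\in C_{i,j}$. Parameterized Inapproximability Hypothesis (PIH): there is a universal constant $\epsilon\in(0,1)$ such that, parameterized by the number $k$ of variables, it is \textsf{W[1]}-hard to distinguish BCSP instances that are satisfiable from those in which every assignment violates at least an $\epsilon$-fraction of the constraints. *)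

(* Defs.v *)
From mathcomp Require Import all_boot all_order all_algebra.
From mathcomp Require Import reals exp.

Set Implicit Arguments.
Unset Strict Implicit.
Unset Printing Implicit Defensive.

Import Order.TTheory GRing.Theory Num.Theory.
Local Open Scope ring_scope.

(* Machine model: finite-control programs acting on stacks of bits.  A program
   mentions finitely many stacks, every basic step touches one stack cell and
   costs 1, and a Turing tape is a pair of stacks; hence programs and multitape
   Turing machines simulate each other with constant-factor overhead in time. *)

Inductive cmd : Type :=
| Skip
| Push of nat & bool
| Pop of nat
| Seq of cmd & cmd
| Case of nat & cmd & cmd & cmd (* top of stack: none / false / true *)
| While of nat & cmd.           (* while the stack is nonempty *)

Definition state := nat -> seq bool.

Definition upd (s : state) (x : nat) (v : seq bool) : state :=
  fun y => if y == x then v else s y.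

(* exec c s t s' : c, started in s, halts in s' after t steps. *)
Inductive exec : cmd -> state -> nat -> state -> Prop :=
| ExecSkip s : exec Skip s 1 s
| ExecPush x b s : exec (Push x b) s 1 (upd s x (b :: s x))
| ExecPop x s : exec (Pop x) s 1 (upd s x (behead (s x)))
| ExecSeq c1 c2 s1 s2 s3 t1 t2 :
    exec c1 s1 t1 s2 -> exec c2 s2 t2 s3 -> exec (Seq c1 c2) s1 (t1 + t2)%N s3
| ExecCase x c0 cf ct s t s' :
    exec (if s x is b :: _ then if b then ct else cf else c0) s t s' ->
    exec (Case x c0 cf ct) s t.+1 s'
| ExecWhileNil x c s : s x = [::] -> exec (While x c) s 1 s
| ExecWhileCons x c s1 s2 s3 t1 t2 :
    s1 x <> [::] -> exec c s1 t1 s2 -> exec (While x c) s2 t2 s3 ->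
    exec (While x c) s1 (t1 + t2).+1 s3.

Definition init (l : seq (seq bool)) : state := nth [::] l.

Definition unary (k : nat) : seq bool := nseq k true.

Definition computable (f : nat -> nat) : Prop :=
  exists c : cmd, forall k, exists t s,
    exec c (init [:: unary k]) t s /\ s 0%N = unary (f k).

(* Parameterized problems: an instance is a pair (x, k) of a bit string and a
   parameter, of size |x| + k. *)

Definition param_language := seq bool -> nat -> Prop.

Record promise_problem := Promise {
  yes : seq bool -> nat -> Prop;
  no : seq bool -> nat -> Prop
}.

Definition language_problem (L : param_language) : promise_problem :=
  Promise L (fun x k => ~ L x k).

(* Many-one fpt-reduction: running time f(k) * poly(|x| + k), new parameter at
   most g(k).  The + 1 only matters for the empty instance. *)
Definition fpt_reduces (L : param_language) (Q : promise_problem) : Prop :=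
  exists (c : cmd) (f g : nat -> nat) (d : nat),
    [/\ computable f, computable g &
      forall x k, exists (t : nat) (s : state) (k' : nat),
        [/\ exec c (init [:: x; unary k]) t s,
            (t <= f k * (size x + k + 1) ^ d)%N,
            s 1%N = unary k',
            (k' <= g k)%N &
            (L x k -> yes Q (s 0%N) k') /\ (~ L x k -> no Q (s 0%N) k')]].

(* All encodings of data below are prefix-free. *)

Definition enc_nat (n : nat) : seq bool := rcons (unary n) false.

Definition enc_seq (T : Type) (e : T -> seq bool) (l : seq T) : seq bool :=
  enc_nat (size l) ++ flatten (map e l).

(* Little-endian binary digits, preceded by their number in unary. *)
Definition enc_bin (n : nat) : seq bool :=
  enc_seq (fun b => [:: b])
    (mkseq (fun i => odd (n %/ 2 ^ i)) (trunc_log 2 n).+1).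

Definition enc_int (z : int) : seq bool := (z < 0) :: enc_bin `|z|%N.

Definition enc_rat (q : rat) : seq bool := enc_int (numq q) ++ enc_int (denq q).

(* Boolean circuits with m inputs: nodes 0, ..., m-1 are the inputs, node m+j is
   the j-th gate, whose arguments are earlier nodes; the last node is the
   output. *)

Inductive gate_kind := AND | OR | NOT.

Record gate := Gate { kind : gate_kind; args : seq nat }.

Definition wf_gate (i : nat) (g : gate) : bool :=
  all (fun a => (a < i)%N) (args g) &&
  (if kind g is NOT then size (args g) == 1%N else (0 < size (args g))%N).

Definition wf_circuit (m : nat) (C : seq gate) : bool :=
  (0 < m)%N &&
  all (fun j => wf_gate (m + j) (nth (Gate AND [::]) C j)) (iota 0 (size C)).

(* Propagates node labels from the inputs and returns the label of the output. *)
Definition propagate (T : Type) (x0 : T) (F : gate -> seq T -> T)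
    (inputs : seq T) (C : seq gate) : T :=
  last x0 (foldl (fun v g => rcons v (F g (map (nth x0 v) (args g)))) inputs C).

Definition eval_gate (g : gate) (v : seq bool) : bool :=
  match kind g with
  | AND => all id v
  | OR => has id v
  | NOT => ~~ head false v
  end.

Definition eval_circuit (C : seq gate) (a : seq bool) : bool :=
  propagate false eval_gate a C.

Definition depth (m : nat) (C : seq gate) : nat :=
  propagate 0%N (fun _ v => (\max_(e <- v) e).+1)%N (nseq m 0%N) C.

(* A gate is large if its fan-in exceeds 2. *)
Definition weft (m : nat) (C : seq gate) : nat :=
  propagate 0%N (fun g v => ((2 < size (args g)) + \max_(e <- v) e)%N)
    (nseq m 0%N) C.

Definition enc_gate (g : gate) : seq bool :=
  match kind g with
  | AND => [:: true; true]
  | OR => [:: true; false]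
  | NOT => [:: false; false]
  end ++ enc_seq enc_nat (args g).

Definition enc_circuit (m : nat) (C : seq gate) : seq bool :=
  enc_nat m ++ enc_seq enc_gate C.

Definition weighted_circuit_sat (t d : nat) : param_language := fun x k =>
  exists (m : nat) (C : seq gate),
    [/\ x = enc_circuit m C, wf_circuit m C, (weft m C <= t)%N,
        (depth m C <= d)%N &
        exists a : m.-tuple bool, count id a = k /\ eval_circuit C a].

Definition W1 (L : param_language) : Prop :=
  exists d, fpt_reduces L (language_problem (weighted_circuit_sat 1 d)).

Definition W1_hard (Q : promise_problem) : Prop :=
  forall L, W1 L -> fpt_reduces L Q.

(* There is one constraint per unordered pair {i, j} of distinct variables,
   C_{i,j} and C_{j,i} being two names for it; its relation is read in the
   order i < j.  No symmetry of the relation itself is assumed. *)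
Record bcsp (k n : nat) := BCSP {
  con : 'I_k -> 'I_k -> {set 'I_n * 'I_n};
  con_sym : forall i j, i != j -> con i j = con j i
}.

Definition satisfies (k n : nat) (I : bcsp k n) (psi : 'I_k -> 'I_n)
    (i j : 'I_k) : bool :=
  (psi i, psi j) \in con I i j.

Definition satisfiable (k n : nat) (I : bcsp k n) : Prop :=
  exists psi : 'I_k -> 'I_n, forall i j : 'I_k, (i < j)%N -> satisfies I psi i j.

Definition violated (k n : nat) (I : bcsp k n) (psi : 'I_k -> 'I_n) : nat :=
  #|[set p : 'I_k * 'I_k | (p.1 < p.2)%N && ~~ satisfies I psi p.1 p.2]|.

(* Prefix-free for fixed k; k is the parameter, hence already part of the
   instance. *)
Definition enc_bcsp (k n : nat) (I : bcsp k n) : seq bool :=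
  enc_nat n ++
  flatten [seq [seq (a, b) \in con I i j | a <- enum 'I_n, b <- enum 'I_n]
          | i <- enum 'I_k, j <- [seq j : 'I_k <- enum 'I_k | (i < j)%N]].

(* When k <= 1 the quotient below is 0 / 0 = 0, so that, eps being positive,
   satisfiable instances are never no-instances. *)
Definition gap_bcsp (R : realType) (eps : R) : promise_problem := Promise
  (fun x k => exists (n : nat) (I : bcsp k n), x = enc_bcsp I /\ satisfiable I)
  (fun x k => exists (n : nat) (I : bcsp k n), x = enc_bcsp I /\
     forall psi : 'I_k -> 'I_n, eps <= (violated I psi)%:R / 'C(k, 2)%:R).

Definition PIH (R : realType) : Prop :=
  exists eps : R, 0 < eps < 1 /\ W1_hard (gap_bcsp eps).

Definition psd (R : realType) (n : nat) (A : 'M[rat]_n) : Prop :=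
  A^T = A /\
  forall v : 'rV[R]_n, 0 <= (v *m map_mx (@ratr R) A *m v^T) 0 0.

Definition principal (F : Type) (n : nat) (A : 'M[F]_n) (S : {set 'I_n}) :
    'M[F]_#|S| :=
  mxsub (@enum_val _ (mem S)) (@enum_val _ (mem S)) A.

(* Principal minors of a positive semi-definite matrix are nonnegative, so the
   default value 0 does not affect the maximum when k <= n. *)
Definition maxdet (n : nat) (A : 'M[rat]_n) (k : nat) : rat :=
  \big[Num.max/0]_(S : {set 'I_n} | #|S| == k) \det (principal A S).

Definition unit_diagonal (n : nat) (A : 'M[rat]_n) : Prop := forall i, A i i = 1.

Definition enc_detmax (n : nat) (A : 'M[rat]_n) (tau : rat) : seq bool :=
  enc_nat n ++
  flatten [seq enc_rat (A i j) | i <- enum 'I_n, j <- enum 'I_n] ++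
  enc_rat tau.

(* The gap problem of approximating the maximum within a factor rho(k) on the
   matrices satisfying D: the instance carries a threshold tau > 0, and one has
   to tell maxdet >= tau from maxdet < rho(k) * tau. *)
Definition gap_detmax (R : realType) (rho : nat -> R)
    (D : forall n, 'M[rat]_n -> Prop) : promise_problem := Promise
  (fun x k => exists (n : nat) (A : 'M[rat]_n) (tau : rat),
     [/\ x = enc_detmax A tau, psd R A, D n A, (0 < k <= n)%N & 0 < tau] /\
     tau <= maxdet A k)
  (fun x k => exists (n : nat) (A : 'M[rat]_n) (tau : rat),
     [/\ x = enc_detmax A tau, psd R A, D n A, (0 < k <= n)%N & 0 < tau] /\
     ratr (maxdet A k) < rho k * ratr tau).

Definition W1_hard_to_approximate_detmax (R : realType) (rho : nat -> R)
    (D : forall n, 'M[rat]_n -> Prop) : Prop :=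
  W1_hard (gap_detmax rho D).

(* Main.v *)
(* Label the cells (i, j) of a k x k grid by pairs (a, b) of values, allowing
   (a, b) at (i, j) if it satisfies the constraint between i < j, if a = b for
   i = j, and always for i > j.  Each labelled cell becomes a unit vector such
   that vectors of neighbouring cells in a row (column) are orthogonal exactly
   when they agree on the row value a (column value b), that two vectors of the
   same cell are never orthogonal, and that inner products are multiples of 1/8.
   One further vector, orthogonal to all others and repeated often enough, fills
   up the k^2 + 1 vectors to be selected.  A satisfying assignment gives an
   orthonormal selection, of determinant 1.  Conversely a selection whose largest
   greedily built orthogonal subset omits m vectors has determinant at most
   (63/64)^m, and that subset labels all but at most m cells consistently; reading
   an assignment off the diagonal violates at most 2km constraints.  Hence
   m >= eps k / 8, while k is about the square root of the number of vectors.
   The matrix has unit diagonal, which settles both claims at once. *)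

Require Import Defs.
From mathcomp Require Import all_boot all_order all_algebra.
From mathcomp Require Import reals exp boolp.
From mathcomp Require Import zify ring lra.

Set Implicit Arguments.
Unset Strict Implicit.
Unset Printing Implicit Defensive.

Import Order.TTheory GRing.Theory Num.Theory.
Local Open Scope ring_scope.

(** * Determinants of positive semi-definite matrices *)

Definition qform (F : realFieldType) (m : nat) (M : 'M[F]_m) (v : 'rV[F]_m) : F :=
  (v *m M *m v^T) 0 0.

(** Any real field is allowed because determinants are bounded over [rat], while the problem asks
    for semi-definiteness over [R]. *)
Definition psdmx (F : realFieldType) (m : nat) (M : 'M[F]_m) : Prop :=
  M^T = M /\ forall v, 0 <= qform M v.

Section Schur.
Variables (F : realFieldType) (m : nat) (a : F) (b : 'rV[F]_m) (D : 'M[F]_m).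
Let M : 'M[F]_(1 + m) := block_mx a%:M b b^T D.
Hypothesis psdM : psdmx M.

Lemma psd_block_sym : D^T = D.
Proof. by have [+ _] := psdM; rewrite tr_block_mx => /eq_block_mx[]. Qed.

Lemma qform_block s x :
  qform M (row_mx s%:M x) = s ^+ 2 * a + 2 * s * (x *m b^T) 0 0 + qform D x.
Proof.
rewrite /qform mul_row_block tr_row_mx mul_row_col !mulmxDl tr_scalar_mx.
rewrite !mul_scalar_mx !mul_mx_scalar !mxE.
rewrite -[\sum_(_ < _) _](_ : (x *m b^T) 0 0 = _); last by rewrite mxE.
rewrite -[\sum_(_ < _) _](_ : (s *: b *m x^T) 0 0 = _); last by rewrite mxE.
rewrite (_ : (s *: b *m x^T) 0 0 = s * (x *m b^T) 0 0); last first.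
  by rewrite -scalemxAl mxE -[in LHS](trmxK b) -trmx_mul [in LHS]mxE.
rewrite ?mulr1n; ring.
Qed.

Lemma psd_block_corner : psdmx D.
Proof.
split=> [|v]; first exact: psd_block_sym.
by have := psdM.2 (row_mx 0%:M v); rewrite qform_block expr0n /= mulr0 !mul0r !add0r.
Qed.

(* The last factor is the squared distance of the first vector to a point of
   the span of the others; the minimum over x is the Schur complement. *)
Lemma det_psd_block x :
  0 <= \det D -> 0 <= \det M <= \det D * qform M (row_mx 1%:M x).
Proof.
move=> D_ge0; have [unitD|] := boolP (D \in unitmx); last first.
  rewrite unitmxE unitfE negbK => /det0P[w w0 wD].
  (* For [w] in the kernel of [D] the form at [(1, t w)] is affine in [t], with slope twice
     [w *m b^T]. A nonzero slope would allow the value -1. Hence [(0, w)] lies in the kernel of [M],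
     and [\det M] vanishes. *)
  have wb : (w *m b^T) 0 0 = 0.
    apply/eqP/negPn/negP => h.
    have := psdM.2 (row_mx 1%:M (- (a + 1) / (2 * (w *m b^T) 0 0) *: w)).
    rewrite qform_block /qform -!scalemxAl wD mul0mx scaler0 !mxE.
    rewrite -[\sum_(_ < _) _](_ : (w *m b^T) 0 0 = _); last by rewrite mxE.
    rewrite expr1n mul1r mulr1 addr0.
    have -> : a + 2 * (- (a + 1) / (2 * (w *m b^T) 0 0) * (w *m b^T) 0 0) = -1.
      by field.
    by rewrite oppr_ge0 ler10.
  have wM : row_mx 0 w *m M = 0.
    rewrite mul_row_block !mul0mx !add0r wD; apply/eqP.
    rewrite -row_mx0; apply/eqP; congr row_mx.
    by apply/matrixP=> i j; rewrite !ord1 wb mxE.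
  have -> : \det M = 0.
    apply/eqP/det0P; exists (row_mx 0 w) => //.
    by rewrite -row_mx0; apply: contra w0 => /eqP/eq_row_mx[_ ->].
  by rewrite lexx mulr_ge0 // psdM.2.
(* The Schur complement: block elimination gives [detM], and completing the square gives [key], with
   value [s] at the point [- (b *m invmx D)]. *)
pose s : F := a - (b *m invmx D *m b^T) 0 0.
have symV : (invmx D)^T = invmx D by rewrite trmx_inv psd_block_sym.
have detM : \det M = \det D * s.
  have -> : M = block_mx 1%:M (b *m invmx D) 0 1%:M
                *m block_mx (a%:M - b *m invmx D *m b^T) 0 b^T D.
    rewrite mulmx_block !mul1mx !mul0mx !add0r -[b *m _ *m D]mulmxA mulVmx //.
    by rewrite mulmx1 subrK.
  rewrite det_mulmx det_ublock det_lblock !det1 !mul1r [RHS]mulrC.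
  by rewrite det_mx11 /s !mxE mulr1n.
have key y : qform M (row_mx 1%:M y) = s + qform D (y + b *m invmx D).
  rewrite qform_block /qform linearD /= trmx_mul symV !mulmxDl !mulmxDr /s.
  rewrite -[b *m _ *m D]mulmxA mulVmx // mulmx1.
  have -> : y *m D *m (invmx D *m b^T) = y *m b^T.
    by rewrite mulmxA -(mulmxA y) mulmxV // mulmx1.
  have -> : b *m (invmx D *m b^T) = b *m invmx D *m b^T by rewrite mulmxA.
  rewrite expr1n mul1r mulr1.
  have -> : ((y *m D *m y^T + y *m b^T + (b *m y^T + b *m invmx D *m b^T)) 0 0
     = (y *m D *m y^T) 0 0 + (y *m b^T) 0 0
       + ((b *m y^T) 0 0 + (b *m invmx D *m b^T) 0 0)) by rewrite !mxE.
  have -> : (b *m y^T) 0 0 = (y *m b^T) 0 0.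
    by rewrite -[in LHS](trmxK b) -trmx_mul [in LHS]mxE.
  ring.
have s_ge0 : 0 <= s.
  have := psdM.2 (row_mx 1%:M (- (b *m invmx D))).
  by rewrite key addNr /qform !mul0mx mxE addr0.
rewrite detM mulr_ge0 //= ler_wpM2l // key lerDl.
exact: psd_block_corner.2.
Qed.

End Schur.

(* Greedy choice of F from the bottom of the matrix: a row outside F is
   non-orthogonal to a later row of F, which costs a factor 1 - d. *)
Lemma det_orthogonal_subset (F : realFieldType) (d : F) (m : nat) (M : 'M[F]_m) :
  0 <= d <= 1 -> psdmx M -> (forall i, M i i = 1) ->
  (forall i j, M i j = 0 \/ d <= M i j ^+ 2) ->
  exists S : {set 'I_m}, [/\ {in S &, forall i j, i != j -> M i j = 0} &
    0 <= \det M <= (1 - d) ^+ (m - #|S|)].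
Proof.
move=> /andP[d0 d1]; elim: m M => [|m IH] M psdM M1 Md.
  by exists set0; split=> [i|]; rewrite ?inE // det_mx00 cards0 expr0 ler01 lexx.
have symM i j : M i j = M j i by rewrite -[in RHS]psdM.1 mxE.
pose M' : 'M[F]_(1 + m) := M.
have defM : M' = block_mx (M' 0 0)%:M (ursubmx M') (ursubmx M')^T (drsubmx M').
  rewrite -[LHS]submxK; congr block_mx.
    by apply/matrixP=> i j; rewrite !ord1 !mxE mulr1n; congr (M' _ _); apply: val_inj.
  by apply/matrixP=> i j; rewrite !mxE; exact: symM.
have psdM' : psdmx (block_mx (M' 0 0)%:M (ursubmx M') (ursubmx M')^T (drsubmx M')).
  by rewrite -defM.
have dr i j : drsubmx M' i j = M (lift ord0 i) (lift ord0 j).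
  by rewrite !mxE; congr (M _ _); apply: val_inj.
have [||S [S0 /andP[D0 D1]]] := IH _ (psd_block_corner psdM').
- by move=> i; rewrite dr M1.
- by move=> i j; rewrite dr; exact: Md.
have Sm : (#|S| <= m)%N by rewrite -[leqRHS]card_ord max_card.
have L0 i j : i \in S -> j \in S -> lift ord0 i != lift ord0 j ->
    M (lift ord0 i) (lift ord0 j) = 0.
  by move=> iS jS ij; rewrite -dr; apply: S0 => //; apply: contraNneq ij => ->.
have [q /andP[qS Mq]|none] := pickP (fun q => (q \in S) && (M ord0 (lift ord0 q) != 0)).
  exists [set lift ord0 i | i in S]; split.
    by move=> _ _ /imsetP[i iS ->] /imsetP[j jS ->]; exact: L0.
  rewrite (card_imset _ lift_inj) subSn // exprSr.
  set e := M ord0 (lift ord0 q) in Mq.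
  (* The point of the span is the projection of the first vector onto the unit vector of [q] alone,
     at squared distance [1 - e ^+ 2]. *)
  have := @det_psd_block _ _ _ _ _ psdM' (- e *: delta_mx 0 q) D0.
  rewrite -defM => /andP[-> le_det] /=; apply: le_trans le_det _.
  have -> : qform M' (row_mx 1%:M (- e *: delta_mx 0 q)) = 1 - e ^+ 2.
    have trZ : (- e *: delta_mx 0 q : 'rV_m)^T = - e *: delta_mx q 0.
      by apply/matrixP=> i j; rewrite !mxE andbC.
    rewrite defM qform_block /qform trZ -!scalemxAl -scalemxAr -!rowE -colE !mxE.
    have -> : M' (rshift 1 q) (rshift 1 q) = 1 by exact: M1.
    have -> : M' (lshift m 0) (rshift 1 q) = e.
      by congr (M _ _); apply: val_inj.
    have -> : M' 0 0 = 1 by exact: M1.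
    ring.
  have [e0|de] := Md ord0 (lift ord0 q); first by rewrite /e e0 eqxx in Mq.
  apply: (le_trans (_ : _ <= \det (drsubmx M') * (1 - d))).
    by rewrite ler_wpM2l // lerB.
  by rewrite ler_wpM2r // subr_ge0.
(* The first row is orthogonal to all of [S] and joins it; the point 0 of the span, at squared
   distance 1, shows that the determinant does not grow. *)
exists (ord0 |: [set lift ord0 i | i in S]); split.
  move=> i j /setU1P[->|/imsetP[i' iS ->]] /setU1P[->|/imsetP[j' jS ->]] //.
  - by have := none j'; rewrite jS /= => /negbFE/eqP.
  - by rewrite symM; have := none i'; rewrite iS /= => /negbFE/eqP.
  - exact: L0.
rewrite cardsU1 (card_imset _ lift_inj) (_ : ord0 \notin _); last first.
  by apply/imsetP=> -[i _ /eqP]; rewrite (negPf (neq_lift _ _)).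
rewrite add1n subSS.
have := @det_psd_block _ _ _ _ _ psdM' 0 D0.
rewrite -defM => /andP[-> le_det] /=; apply: le_trans le_det _.
have -> : qform M' (row_mx 1%:M 0) = 1.
  rewrite defM qform_block /qform !mul0mx !mxE !mulr0 !addr0 expr1n mul1r.
  exact: M1.
by rewrite mulr1.
Qed.

(** * Vectors of labelled cells *)

(** Grouping the terms by the value of [key] turns the form into a sum of squares. *)
Lemma psd_equality_kernel (F : realDomainType) (I : finType) (T : eqType)
    (key : I -> T) (y : I -> F) :
  0 <= \sum_p \sum_q y p * y q * (key p == key q)%:R.
Proof.
pose U := undup [seq key p | p <- enum I].
have -> : \sum_p \sum_q y p * y q * (key p == key q)%:R =
          \sum_(z <- U) (\sum_p y p * (key p == z)%:R) ^+ 2.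
  under [RHS]eq_bigr => z _.
    rewrite expr2 mulr_suml.
    under eq_bigr => p _ do rewrite mulr_sumr.
    over.
  rewrite [RHS]exchange_big; apply: eq_bigr => p _ /=.
  rewrite [RHS]exchange_big; apply: eq_bigr => q _ /=.
  rewrite (bigD1_seq (key p)) ?undup_uniq //=; last first.
    by rewrite mem_undup map_f ?mem_enum.
  rewrite eqxx big1 => [|z /negPf]; first by rewrite addr0 mulr1 mulrA [key q == _]eq_sym.
  by rewrite eq_sym => ->; rewrite mulr0 mul0r.
by apply: sumr_ge0 => z _; rewrite sqr_ge0.
Qed.

(* 8 times the inner product of the part of a cell vector that encodes the
   value a shared along a line: cell (i, j) contributes x_a to its right border
   and y_a to its left border, where x_a = u_0 + u_a and y_a = u_0 - u_a for
   orthonormal u_0, u_1, .. attached to the border. *)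
Definition link (i j a i' j' a' : nat) : nat :=
  (i == i') * ((j == j') * (2 + 2 * (a == a'))
              + ((j == j'.+1) || (j' == j.+1)) * (a != a')).

(** The borders of a cell are numbered [j] and [j + 1]. The first summand collects the components
    along u_0, the second those along u_a, whose sign is -1 at border [j + 1]. *)
Lemma link_features (F : comNzRingType) i j a i' j' a' :
  (link i j a i' j' a')%:R =
  \sum_(s : bool) \sum_(s' : bool)
     (((i, j + s) == (i', j' + s'))%N%:R +
      (-1) ^+ s * (-1) ^+ s' * ((i, j + s, a) == (i', j' + s', a'))%N%:R) :> F.
Proof.
rewrite !big_bool /= /link !xpair_eqE !addn0 !addn1 eqSS expr0 expr1.
rewrite [j' == _]eq_sym.
case: (i == i') => /=; last by rewrite mul0n; ring.
rewrite mul1n; have [->|nj] := eqVneq j j'.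
  rewrite ?(gtn_eqF (ltnSn _)) ?(ltn_eqF (ltnSn _)) mul1n addn0.
  by case: (a == a') => /=; ring.
have [->|_] := eqVneq j j'.+1.
  rewrite (_ : (j'.+2 == j') = false); last by lia.
  by case: (a == a') => /=; ring.
by case: (j.+1 == j'); case: (a == a') => /=; ring.
Qed.

(** With the signs absorbed into the coefficients, both summands of [link_features] are equality
    kernels on pairs of a vector and one of its borders. *)
Lemma link_psd (F : realDomainType) (I : finType) (i j a : I -> nat) (x : I -> F) :
  0 <= \sum_p \sum_q x p * x q * (link (i p) (j p) (a p) (i q) (j q) (a q))%:R.
Proof.
have -> : \sum_p \sum_q x p * x q * (link (i p) (j p) (a p) (i q) (j q) (a q))%:R
  = \sum_(p : I * bool) \sum_(q : I * bool) x p.1 * x q.1 *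
       ((i p.1, j p.1 + p.2) == (i q.1, j q.1 + q.2))%N%:R
  + \sum_(p : I * bool) \sum_(q : I * bool)
       ((-1) ^+ p.2 * x p.1) * ((-1) ^+ q.2 * x q.1) *
       ((i p.1, j p.1 + p.2, a p.1) == (i q.1, j q.1 + q.2, a q.1))%N%:R.
  have flat (G : I * bool -> I * bool -> F) : \sum_p \sum_q G p q =
      \sum_p \sum_q \sum_s \sum_s' G (p, s) (q, s').
    transitivity (\sum_p \sum_s \sum_q G (p, s) q).
      by rewrite [RHS]pair_bigA; apply: eq_bigr => -[].
    apply: eq_bigr => p _; rewrite [RHS]exchange_big; apply: eq_bigr => s _ /=.
    by rewrite [RHS]pair_bigA; apply: eq_bigr => -[].
  rewrite !flat -big_split; apply: eq_bigr => p _.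
  rewrite -big_split; apply: eq_bigr => q _.
  rewrite link_features !big_bool /=; ring.
by rewrite addr_ge0 ?(psd_equality_kernel (fun p : I * bool => _)).
Qed.

Definition cell := (nat * nat * nat * nat)%type.

(** Rows transmit [a] and columns transmit [b]. Two vectors of one cell get 4, 6 or 8, those of
    adjacent cells 0 or 1, all others 0. *)
Definition ip (u v : cell) : nat :=
  let: (i, j, a, b) := u in let: (i', j', a', b') := v in
  link i j a i' j' a' + link j i b j' i' b'.

Lemma ip_psd (F : realDomainType) (I : finType) (f : I -> cell) (x : I -> F) :
  0 <= \sum_p \sum_q x p * x q * (ip (f p) (f q))%:R.
Proof.
have := addr_ge0
  (link_psd (fun p => (f p).1.1.1) (fun p => (f p).1.1.2) (fun p => (f p).1.2) x)
  (link_psd (fun p => (f p).1.1.2) (fun p => (f p).1.1.1) (fun p => (f p).2) x).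
rewrite -big_split /=; under eq_bigr => p _ do rewrite -big_split /=.
congr (0 <= _); apply: eq_bigr => p _; apply: eq_bigr => q _.
by case: (f p) (f q) => [[[? ?] ?] ?] [[[? ?] ?] ?] /=; rewrite natrD mulrDr.
Qed.

Lemma linkC i j a i' j' a' : link i j a i' j' a' = link i' j' a' i j a.
Proof.
by rewrite /link [i' == i]eq_sym [j' == j]eq_sym [a' == a]eq_sym
  [X in (_ + nat_of_bool X * _)%N]orbC.
Qed.

Lemma ipC u v : ip u v = ip v u.
Proof. by case: u v => [[[i j] a] b] [[[i' j'] a'] b'] /=; congr addn; exact: linkC. Qed.

Lemma ipxx u : ip u u = 8.
Proof. by case: u => [[[i j] a] b]; rewrite /ip /link !eqxx !muln0. Qed.

Definition gram (F : fieldType) (m : nat) (f : 'I_m -> cell) : 'M[F]_m :=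
  \matrix_(p, q) ((ip (f p) (f q))%:R / 8).

Lemma gram_psd (F : realFieldType) m (f : 'I_m -> cell) : psdmx (gram F f).
Proof.
split=> [|v]; first by apply/matrixP=> p q; rewrite !mxE ipC.
have -> : qform (gram F f) v =
    (\sum_p \sum_q v 0 p * v 0 q * (ip (f p) (f q))%:R) / 8.
  rewrite /qform mxE mulr_suml; under [RHS]eq_bigr => p _ do rewrite mulr_suml.
  rewrite [RHS]exchange_big /=; apply: eq_bigr => q _.
  rewrite !mxE mulr_suml; apply: eq_bigr => p _; rewrite !mxE; ring.
by rewrite divr_ge0 ?ip_psd.
Qed.

(** A nonzero entry is at least 1/8, so its square is at least 1/64 and each row outside [S] costs a
    factor 63/64. *)
Lemma gram_det (F : realFieldType) m (f : 'I_m -> cell) :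
  exists S : {set 'I_m}, {in S &, forall p q, p != q -> ip (f p) (f q) = 0%N} /\
    0 <= \det (gram F f) <= (63 / 64) ^+ (m - #|S|).
Proof.
have [|||S [S0 SD]] := @det_orthogonal_subset F (1 / 64) m (gram F f) _ (gram_psd F f).
- by apply/andP; split; lra.
- by move=> p; rewrite mxE ipxx; field.
- move=> p q; rewrite mxE; case: (ip _ _) => [|e]; [left|right].
    by rewrite mul0r.
  have : 1 <= e.+1%:R :> F by rewrite ler1n.
  by move=> h; nra.
exists S; split.
  move=> p q pS qS pq; have /eqP := S0 p q pS qS pq.
  by rewrite mxE mulf_eq0 invr_eq0 !pnatr_eq0 orbF => /eqP.
by rewrite (_ : 63 / 64 = 1 - 1 / 64) //; field.
Qed.

Arguments ip : simpl never.

Local Close Scope ring_scope.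

(** * The grid of a constraint satisfaction problem *)

(** Both the cells and the relation bits are listed in this form, so one loop invariant serves to
    turn the bits into cells. *)
Definition upto (T : Type) (f : nat -> seq T) (m : nat) : seq T :=
  flatten [seq f x | x <- iota 0 m].

Lemma uptoS T (f : nat -> seq T) m : upto f m.+1 = upto f m ++ f m.
Proof. by rewrite /upto -addn1 iotaD map_cat flatten_cat /= cats0. Qed.

Lemma mem_upto (T : eqType) (f : nat -> seq T) m c :
  reflect (exists2 x, x < m & c \in f x) (c \in upto f m).
Proof.
apply: (iffP flatten_mapP) => -[x].
  by rewrite mem_iota => xm cx; exists x.
by move=> xm cx; exists x; rewrite ?mem_iota.
Qed.

Lemma size_upto_ge T (f : nat -> seq T) d m :
  (forall x, x < m -> d <= size (f x)) -> m * d <= size (upto f m).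
Proof.
elim: m => // m IH h; rewrite uptoS size_cat mulSn addnC leq_add ?h //.
by apply: IH => x xm; apply: h; apply: ltnW.
Qed.

Section Cells.
Variables (ok : nat -> nat -> nat -> nat -> bool) (k n : nat).

Definition keep i j a b := if i < j then ok i j a b else (i == j) ==> (a == b).

(* Out of reach of the k x k grid, hence orthogonal to all its cells. *)
Definition dummy : cell := (k.+1, 0, 0, 0).

Definition slot_cells i j : seq cell :=
  upto (fun a => upto (fun b => if keep i j a b then [:: (i, j, a, b)] else [::]) n) n.

(** One dummy per slot and a final one give [k ^ 2 + 1] copies, enough for a selection of that size
    even if no label is allowed anywhere. *)
Definition cells : seq cell :=
  upto (fun i => upto (fun j => dummy :: slot_cells i j) k) k ++ [:: dummy].

Lemma mem_cells c : c \in cells -> c != dummy ->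
  exists i j a b, [/\ c = (i, j, a, b), i < k, j < k, a < n & b < n] /\ keep i j a b.
Proof.
rewrite mem_cat mem_seq1 => /orP[|->] //.
move=> /mem_upto[i ik /mem_upto[j jk]]; rewrite inE => /orP[->//|].
move=> /mem_upto[a an /mem_upto[b bn]]; case: ifP => // kp; rewrite inE => /eqP-> _.
by exists i, j, a, b.
Qed.

Lemma in_cells i j a b : i < k -> j < k -> a < n -> b < n -> keep i j a b ->
  (i, j, a, b) \in cells.
Proof.
move=> ik jk an bn kp; rewrite mem_cat; apply/orP; left.
apply/mem_upto; exists i => //; apply/mem_upto; exists j => //; rewrite inE.
apply/orP; right; apply/mem_upto; exists a => //; apply/mem_upto; exists b => //.
by rewrite kp inE.
Qed.

Lemma dummy_cells : dummy \in cells.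
Proof. by rewrite mem_cat inE eqxx orbT. Qed.

Lemma size_cells : (k ^ 2).+1 <= size cells.
Proof.
rewrite size_cat addn1 ltnS expnS expn1; apply: size_upto_ge => i _.
by rewrite -[leqLHS]muln1; apply: size_upto_ge.
Qed.

End Cells.

(** * Orthogonal selections versus assignments *)

Section Reduction.
Variables (k n : nat) (I : bcsp k n) (ok : nat -> nat -> nat -> nat -> bool).
Hypothesis okP : forall (i j : 'I_k) (a b : 'I_n), ok i j a b = ((a, b) \in con I i j).

Let N := size (cells ok k n).
Let f (u : 'I_N) : cell := nth (dummy k) (cells ok k n) u.

(** Slot [(i, j)] contributes its cell labelled [(psi i, psi j)]: neighbours in a row share the
    first value, neighbours in a column the second. One dummy completes the selection. *)
Lemma satisfiable_orthogonal : satisfiable I ->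
  exists S : {set 'I_N}, #|S| = (k ^ 2).+1 /\
    {in S &, forall u v, u != v -> ip (f u) (f v) = 0}.
Proof.
move=> [psi psiP].
pose sel (x : option ('I_k * 'I_k)) : cell :=
  if x is Some (i, j) then (val i, val j, val (psi i), val (psi j)) else dummy k.
have /fin_all_exists[g gP] x : exists u, f u = sel x.
  have selin : sel x \in cells ok k n.
    case: x => [[i j]|]; last exact: dummy_cells.
    apply: in_cells; rewrite ?ltn_ord //; rewrite /keep; case: ltnP => [ij|_].
      by rewrite okP; exact: psiP.
    by apply/implyP => /eqP/val_inj->.
  have lt : index (sel x) (cells ok k n) < N by rewrite index_mem.
  by exists (Ordinal lt); rewrite /f nth_index.
have sel0 x y : x != y -> ip (sel x) (sel y) = 0.
  (* The dummy sits in row [k.+1] because row [k] would still be adjacent to the last row [k - 1] of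
     the grid. *)
  have aux (i j a b : nat) : i < k -> j < k -> ip (dummy k) (i, j, a, b) = 0.
    move=> ik jk; rewrite /ip /dummy /link (_ : (k.+1 == i) = false); last lia.
    rewrite !mul0n (_ : (i == k.+2) = false); last lia.
    by rewrite (_ : (k.+1 == i.+1) = false) ?muln0 //; lia.
  case: x y => [[i j]|] [[i' j']|] //= xy; [|by rewrite ipC aux|by rewrite aux].
  rewrite /ip /link; have [ii|ii] := eqVneq i i'; have [jj|jj] := eqVneq j j'.
  - by rewrite ii jj eqxx in xy.
  - by rewrite ii !eqxx !(inj_eq val_inj) (negPf jj) !muln0.
  - by rewrite jj !eqxx !(inj_eq val_inj) (negPf ii) !muln0.
  - by rewrite !(inj_eq val_inj) (negPf ii) (negPf jj).
have g_inj : injective g.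
  move=> x y gxy; apply/eqP/negPn/negP => /sel0.
  by rewrite -!gP gxy ipxx.
exists [set g x | x : option ('I_k * 'I_k)]; split.
  by rewrite card_imset // card_option card_prod card_ord expnS expn1.
move=> _ _ /imsetP[x _ ->] /imsetP[y _ ->] gxy; rewrite !gP; apply: sel0.
by apply: contra gxy => /eqP->.
Qed.

(* A cell position is missed if F selects no vector there.  Along a row, or a
   column, without a missed position, orthogonality of neighbours propagates
   the shared value; so the assignment read off the diagonal satisfies every
   constraint (i, j) with nothing missed in row i and column j. *)
Lemma orthogonal_violated m (h : 'I_m -> cell) (F : {set 'I_m}) :
  (forall p, h p \in cells ok k n) ->
  {in F &, forall p q, p != q -> ip (h p) (h q) = 0} ->
  0 < n -> exists psi, violated I psi <= 2 * k * ((k ^ 2).+1 - #|F|).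
Proof.
move=> hin F0 n0.
pose at_ (i j : nat) (p : 'I_m) := (p \in F) && ((h p).1.1.1 == i) && ((h p).1.1.2 == j).
pose w i j : cell := if [pick p | at_ i j p] is Some p then h p else (0, 0, 0, 0).
pose miss := [set x : 'I_k * 'I_k | ~~ [exists p, at_ x.1 x.2 p]].
have wP (x : 'I_k * 'I_k) : x \notin miss -> exists a b,
    [/\ w x.1 x.2 = (val x.1, val x.2, a, b), a < n, b < n, keep ok x.1 x.2 a b &
        exists2 p, p \in F & h p = w x.1 x.2].
  rewrite inE negbK => /existsP[p0 ap0].
  rewrite /w; case: pickP => [p /andP[/andP[pF /eqP e1] /eqP e2]|/(_ p0)]; last by rewrite ap0.
  have [|i [j [a [b [[hp ik jk an bn] kp]]]]] := mem_cells (hin p).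
    apply/eqP => hd; move: e1; rewrite hd /= => e.
    by have := ltn_ord x.1; lia.
  rewrite hp /= in e1 e2; exists a, b; rewrite hp e1 e2 in kp *; split=> //.
  by exists p => //; rewrite hp e1 e2.
(* At a missed diagonal position the value is arbitrary; the constraints affected lie in the row or
   column of that position and are charged to it. *)
pose psi (i : 'I_k) : 'I_n := insubd (Ordinal n0) (w i i).1.2.
have adj (x y : 'I_k * 'I_k) : x \notin miss -> y \notin miss -> x != y ->
    ip (w x.1 x.2) (w y.1 y.2) = 0.
  move=> /wP[a [b [wx _ _ _ [p pF hp]]]] /wP[a' [b' [wy _ _ _ [q qF hq]]]] xy.
  rewrite -hp -hq; apply: F0 => //; apply: contra xy => /eqP pq.
  move: hp; rewrite pq hq wx wy => -[/val_inj e1 /val_inj e2 _ _].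
  by rewrite [x]surjective_pairing [y]surjective_pairing e1 e2.
have row (i : 'I_k) : (forall j, (i, j) \notin miss) ->
    forall j : 'I_k, (w i j).1.2 = (w i i).1.2.
  (* All cells of the row are compared with its column 0, by induction on [j]; [z] names that
     column, since ['I_k] has no canonical zero. *)
  move=> nm; suff all0 (j : nat) (jk : j < k) (z : 'I_k) : val z = 0 -> (w i j).1.2 = (w i z).1.2.
    have k0 : 0 < k by exact: leq_ltn_trans (ltn_ord i).
    move=> j; rewrite (all0 j (ltn_ord j) (Ordinal k0)) //.
    by rewrite (all0 i (ltn_ord i) (Ordinal k0)).
  move=> z0; elim: j jk => [|j IH] jk; first by rewrite z0.
  rewrite -(IH (ltnW jk)).
  have [a [b [w1 _ _ _ _]]] := wP _ (nm (Ordinal jk)).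
  have [a' [b' [w2 _ _ _ _]]] := wP _ (nm (Ordinal (ltnW jk))).
  have := @adj (i, Ordinal jk) (i, Ordinal (ltnW jk)) (nm _) (nm _).
  rewrite /= in w1 w2 *; rewrite w1 w2 /ip /link !eqxx.
  have -> : (i, Ordinal jk) != (i, Ordinal (ltnW jk)).
    by rewrite xpair_eqE eqxx -(inj_eq val_inj) /= gtn_eqF.
  by rewrite (gtn_eqF (ltnSn j)) => /(_ isT); case: (eqVneq a a') => [//|_]; lia.
have col (j : 'I_k) : (forall i, (i, j) \notin miss) ->
    forall i : 'I_k, (w i j).2 = (w j j).2.
  move=> nm; suff all0 (i : nat) (ik : i < k) (z : 'I_k) : val z = 0 -> (w i j).2 = (w z j).2.
    have k0 : 0 < k by exact: leq_ltn_trans (ltn_ord j).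
    move=> i; rewrite (all0 i (ltn_ord i) (Ordinal k0)) //.
    by rewrite (all0 j (ltn_ord j) (Ordinal k0)).
  move=> z0; elim: i ik => [|i IH] ik; first by rewrite z0.
  rewrite -(IH (ltnW ik)).
  have [a [b [w1 _ _ _ _]]] := wP _ (nm (Ordinal ik)).
  have [a' [b' [w2 _ _ _ _]]] := wP _ (nm (Ordinal (ltnW ik))).
  have := @adj (Ordinal ik, j) (Ordinal (ltnW ik), j) (nm _) (nm _).
  rewrite /= in w1 w2 *; rewrite w1 w2 /ip /link !eqxx.
  have -> : (Ordinal ik, j) != (Ordinal (ltnW ik), j).
    by rewrite xpair_eqE eqxx andbT -(inj_eq val_inj) /= gtn_eqF.
  by rewrite (gtn_eqF (ltnSn i)) => /(_ isT); case: (eqVneq b b') => [//|_]; lia.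
(* Cell [(i, j)] carries the row value of [(i, i)] and the column value of [(j, j)]. The two labels
   of a diagonal cell agree, so this is [(psi i, psi j)], which [keep] admits. *)
have sat (i j : 'I_k) : i < j -> (forall l, (i, l) \notin miss) ->
    (forall l, (l, j) \notin miss) -> satisfies I psi i j.
  move=> ij ri cj; have [a [b [wij an bn kp _]]] := wP _ (ri j).
  have [a' [b' [wii an' _ _ _]]] := wP _ (ri i).
  have [a'' [b'' [wjj an'' _ kpj _]]] := wP _ (cj j).
  rewrite /= in wij wii wjj kp kpj.
  have := row i ri j; rewrite wij wii /= => e1.
  have := col j cj i; rewrite wij wjj /= => e2.
  rewrite /keep ltnn eqxx /= in kpj; move/eqP: kpj => e3.
  rewrite /keep ij in kp; rewrite /satisfies -okP /psi wii wjj /=.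
  by rewrite !val_insubd an' an'' -e1 e3 -e2.
exists psi.
(* Two vectors of the same slot, or two dummies, are never orthogonal, so [pos] embeds [F] into the
   unmissed positions plus [None] for the dummy. *)
have miss_le : #|miss| <= (k ^ 2).+1 - #|F|.
  pose pos p : option ('I_k * 'I_k) :=
    if insub (h p).1.1.1 is Some i then if insub (h p).1.1.2 is Some j then Some (i, j)
    else None else None.
  have posP p : p \in F -> pos p \in None |: [set Some x | x in ~: miss].
    move=> pF; rewrite /pos; case: insubP => [i ik e1|_]; last by rewrite setU11.
    case: insubP => [j jk e2|_]; last by rewrite setU11.
    apply/setU1P; right; apply/imsetP; exists (i, j) => //.
    by rewrite !inE negbK; apply/existsP; exists p; rewrite /at_ pF /= e1 e2 !eqxx.
  have pos_inj : {in F &, injective pos}.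
    move=> p q pF qF pq; apply/eqP/negPn/negP => /(F0 p q pF qF).
    have [hp|/(mem_cells (hin p))] := eqVneq (h p) (dummy k);
    have [hq|/(mem_cells (hin q))] := eqVneq (h q) (dummy k).
    - by rewrite hp hq ipxx.
    - move=> [i [j [a [b [[hq' ik jk _ _] _]]]]]; move: pq; rewrite /pos hp hq' /=.
      by rewrite insubF ?insubT //; lia.
    - move=> [i [j [a [b [[hp' ik jk _ _] _]]]]]; move: pq; rewrite /pos hq hp' /=.
      by rewrite insubT insubT insubF //; lia.
    - move=> [i [j [a [b [[hq' ik jk _ _] _]]]]] [i' [j' [a' [b' [[hp' ik' jk' _ _] _]]]]].
      move: pq; rewrite /pos hp' hq' /= !insubT => -[-> ->].
      by rewrite /ip /link !eqxx.
  have : #|F| <= #|None |: [set Some x | x in ~: miss]|.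
    rewrite -(card_in_imset pos_inj) subset_leq_card //.
    by apply/subsetP => _ /imsetP[p pF ->]; exact: posP.
  rewrite cardsU1 card_imset; last by move=> ? ? [].
  have : #|miss| + #|~: miss| = k ^ 2 by rewrite cardsC card_prod card_ord expnS expn1.
  by case: (_ \notin _) => /=; lia.
apply: (@leq_trans (2 * k * #|miss|)); last by rewrite leq_mul2l miss_le orbT.
(* By [sat], a violated pair lies in the row or column of a missed position, and such a cross has at
   most [2 * k] elements. *)
pose cross (x : 'I_k * 'I_k) : {set 'I_k * 'I_k} :=
  [set (x.1, j) | j : 'I_k] :|: [set (i, x.2) | i : 'I_k].
apply: (@leq_trans #|\bigcup_(x in miss) cross x|).
  apply/subset_leq_card/subsetP => -[i j]; rewrite inE /= => /andP[ij ns].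
  have [/existsP[l lm]|/existsPn nr] := boolP [exists l, (i, l) \in miss].
    by apply/bigcupP; exists (i, l) => //; rewrite inE imset_f.
  have [/existsP[l lm]|/existsPn nc] := boolP [exists l, (l, j) \in miss].
    by apply/bigcupP; exists (l, j) => //; rewrite inE orbC imset_f.
  by case/negP: ns; apply: sat.
apply: leq_trans (_ : \sum_(x in miss) 2 * k <= _); last by rewrite sum_nat_const mulnC.
elim/big_rec2: _ => [|x y A _ le]; first by rewrite cards0.
apply: leq_trans (leq_card_setU _ _) _; rewrite leq_add // mul2n -addnn.
apply: leq_trans (leq_card_setU _ _) _.
by rewrite leq_add // (leq_trans (leq_imset_card _ _)) // card_ord.
Qed.

End Reduction.

(** * Stack programs *)

(* Only the first (size l) stacks are described; the others may hold anything. *)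
Definition holds (l : seq (seq bool)) (s : state) : Prop :=
  forall i, i < size l -> s i = nth [::] l i.

(** A total-correctness triple whose time is only bounded from above, so that branches of different
    cost can share one bound. *)
Definition runs (l : seq (seq bool)) (c : cmd) (T : nat) (l' : seq (seq bool)) : Prop :=
  forall s, holds l s -> exists t s', [/\ exec c s t s', t <= T & holds l' s'].

Lemma runs_le l c T T' l' : runs l c T l' -> T <= T' -> runs l c T' l'.
Proof.
move=> h le s /h[t [s' [e tT hs]]]; exists t, s'; split=> //.
exact: leq_trans le.
Qed.

Lemma runs_post l c T l1 l' : runs l c T l1 -> l1 = l' -> runs l c T l'.
Proof. by move=> + <-. Qed.

Lemma holds_nth l1 l' s : size l' <= size l1 ->
  (forall i, i < size l' -> nth [::] l1 i = nth [::] l' i) -> holds l1 s -> holds l' s.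
Proof. by move=> sz e h i il; rewrite h ?e // (leq_trans il). Qed.

Lemma runs_nth l c T l1 l' : runs l c T l1 -> size l' <= size l1 ->
  (forall i, i < size l' -> nth [::] l1 i = nth [::] l' i) -> runs l c T l'.
Proof.
move=> h sz e s /h[t [s' [ex tT hs]]]; exists t, s'; split=> //.
exact: holds_nth hs.
Qed.

Lemma runs_skip l : runs l Skip 1 l.
Proof. by move=> s hs; exists 1, s; split=> //; constructor. Qed.

Lemma runs_push l x b : x < size l ->
  runs l (Push x b) 1 (set_nth [::] l x (b :: nth [::] l x)).
Proof.
move=> xl s hs; exists 1, (upd s x (b :: s x)); split=> // [|i]; first by constructor.
rewrite size_set_nth (maxn_idPr xl) nth_set_nth /= /upd => il.
by case: eqP => _; rewrite hs.
Qed.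

Lemma runs_pop l x : x < size l ->
  runs l (Pop x) 1 (set_nth [::] l x (behead (nth [::] l x))).
Proof.
move=> xl s hs; exists 1, (upd s x (behead (s x))); split=> // [|i]; first by constructor.
rewrite size_set_nth (maxn_idPr xl) nth_set_nth /= /upd => il.
by case: eqP => _; rewrite hs.
Qed.

Lemma runs_seq l l1 l' c1 c2 T1 T2 :
  runs l c1 T1 l1 -> runs l1 c2 T2 l' -> runs l (Seq c1 c2) (T1 + T2) l'.
Proof.
move=> h1 h2 s /h1[t1 [s1 [e1 le1 /h2[t2 [s2 [e2 le2 hs]]]]]].
by exists (t1 + t2), s2; split; [exact: ExecSeq e1 e2 | exact: leq_add |].
Qed.

Lemma runs_case l x c0 cf ct T l' : x < size l ->
  runs l (if nth [::] l x is b :: _ then if b then ct else cf else c0) T l' ->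
  runs l (Case x c0 cf ct) T.+1 l'.
Proof.
move=> xl h s hs; have [t [s' [e tT hs']]] := h s hs.
by exists t.+1, s'; split=> //; apply: ExecCase; rewrite hs.
Qed.

Lemma runs_case_nil l x c d T l' : x < size l ->
  runs l (if nth [::] l x is [::] then c else d) T l' -> runs l (Case x c d d) T.+1 l'.
Proof. by move=> xl h; apply: runs_case => //; case: (nth _ _ _) h => // -[]. Qed.

Lemma runs_while_nil l x c : x < size l -> nth [::] l x = [::] ->
  runs l (While x c) 1 l.
Proof.
by move=> xl e s hs; exists 1, s; split=> //; apply: ExecWhileNil; rewrite hs.
Qed.

Lemma runs_while_cons l l1 l' x c T1 T2 : x < size l -> nth [::] l x <> [::] ->
  runs l c T1 l1 -> runs l1 (While x c) T2 l' ->
  runs l (While x c) (T1 + T2).+1 l'.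
Proof.
move=> xl e h1 h2 s hs; have [t1 [s1 [e1 le1 /h2[t2 [s2 [e2 le2 hs']]]]]] := h1 s hs.
exists (t1 + t2).+1, s2; split=> //; last by rewrite ltnS leq_add.
by apply: ExecWhileCons e1 e2; rewrite hs.
Qed.

Definition for_ x c := While x (Seq (Pop x) c).

(** [tau] is indexed by the number of rounds left, which is the content of the counter. Each round
    pays two extra steps, for the test and the pop. *)
Lemma runs_for (tau : nat -> seq (seq bool)) x c T m :
  (forall i, i < m ->
     [/\ x < size (tau i.+1), nth [::] (tau i.+1) x = unary i.+1 &
         runs (set_nth [::] (tau i.+1) x (unary i)) c T (tau i)]) ->
  x < size (tau 0) -> nth [::] (tau 0) x = [::] ->
  runs (tau m) (for_ x c) (m * (T + 2) + 1) (tau 0).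
Proof.
move=> h x0 n0; elim: m h => [|m IH] h; first exact: runs_while_nil.
have [xs nx body] := h m (ltnSn m).
apply: (runs_le (T := ((1 + T) + (m * (T + 2) + 1)).+1)); last lia.
apply: runs_while_cons; rewrite ?nx //.
  by apply: runs_seq body; have := runs_pop xs; rewrite nx.
by apply: IH => i im; apply: h; apply: ltnW.
Qed.

(** For loops over an encoded list: [sigma d r] describes the stacks when [d] is treated and [r] is
    still to be read from stack [x]. *)
Lemma runs_each (A : Type) (sigma : seq A -> seq A -> seq (seq bool)) x c T (items : seq A) :
  (forall d a r, items = d ++ a :: r ->
     [/\ x < size (sigma d (a :: r)), nth [::] (sigma d (a :: r)) x <> [::] &
         runs (sigma d (a :: r)) c T (sigma (rcons d a) r)]) ->
  x < size (sigma items [::]) -> nth [::] (sigma items [::]) x = [::] ->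
  runs (sigma [::] items) (While x c) (size items * T.+1 + 1) (sigma items [::]).
Proof.
move=> h x0 n0; suff gen d r : items = d ++ r ->
    runs (sigma d r) (While x c) (size r * T.+1 + 1) (sigma items [::]).
  exact: gen.
elim: r d => [|a r IH] d e.
  by rewrite cats0 in e; rewrite -e; apply: runs_while_nil.
have [xs nx body] := h d a r e.
apply: (runs_le (T := (T + (size r * T.+1 + 1)).+1)); last by rewrite /=; lia.
by apply: runs_while_cons body _ => //; apply: IH; rewrite cat_rcons.
Qed.

(** * Elementary programs: clearing, copying, reading and subtracting *)

Ltac nth_cases :=
  rewrite ?size_set_nth; rewrite ?nth_set_nth /=;
  repeat (case: eqP => ?; subst => //; rewrite ?nth_set_nth /=).

Ltac sz_tac := rewrite ?size_set_nth; lia.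

Definition clear x := While x (Pop x).

Lemma runs_clear l x : x < size l ->
  runs l (clear x) (2 * size (nth [::] l x) + 1) (set_nth [::] l x [::]).
Proof.
move=> xl; move e: (nth [::] l x) => w; elim: w l xl e => [|b w IH] l xl e.
  apply: runs_nth (runs_while_nil _ xl e) _ _ => [|i].
    by sz_tac.
  by move=> _; nth_cases.
apply: (runs_le (T := (1 + (2 * size w + 1)).+1)); last by rewrite /=; lia.
apply: runs_while_cons (runs_pop xl) _ => //; first by rewrite e.
rewrite e /=; apply: runs_nth (IH _ _ _) _ _.
- by sz_tac.
- by nth_cases.
- by sz_tac.
- by move=> i _; nth_cases.
Qed.

Definition move_ x y :=
  While x (Case x Skip (Seq (Pop x) (Push y false)) (Seq (Pop x) (Push y true))).

Lemma runs_move l x y : x < size l -> y < size l -> x != y ->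
  runs l (move_ x y) (4 * size (nth [::] l x) + 1)
    (set_nth [::] (set_nth [::] l x [::]) y (rev (nth [::] l x) ++ nth [::] l y)).
Proof.
move=> xl yl /eqP xy; move e: (nth [::] l x) => w; elim: w l xl yl e => [|b w IH] l xl yl e.
  apply: runs_nth (runs_while_nil _ xl e) _ _ => [|i].
    by sz_tac.
  by move=> _; nth_cases.
apply: (runs_le (T := (3 + (4 * size w + 1)).+1)); last by rewrite /=; lia.
pose l1 := set_nth [::] (set_nth [::] l x w) y (b :: nth [::] l y).
apply: (runs_while_cons (l1 := l1)) => //; first by rewrite e.
  apply: runs_case => //; rewrite e.
  have step c : runs l (Seq (Pop x) (Push y c)) 2
      (set_nth [::] (set_nth [::] l x w) y (c :: nth [::] l y)).
    apply: runs_seq (runs_pop xl) _; rewrite e /=.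
    apply: runs_post; first by apply: runs_push; sz_tac.
    by congr set_nth; nth_cases.
  by rewrite /l1; case: (b); exact: step.
have sz : size l1 = size l by sz_tac.
apply: runs_nth (IH l1 _ _ _) _ _; rewrite ?sz //.
- by rewrite /l1; nth_cases.
- by sz_tac.
- by move=> i _; rewrite rev_cons cat_rcons /l1; nth_cases.
Qed.

Definition move2 z x y :=
  While z (Case z Skip (Seq (Pop z) (Seq (Push x false) (Push y false)))
                       (Seq (Pop z) (Seq (Push x true) (Push y true)))).

Lemma runs_move2 l z x y : z < size l -> x < size l -> y < size l ->
  z != x -> z != y -> x != y ->
  runs l (move2 z x y) (5 * size (nth [::] l z) + 1)
    (set_nth [::] (set_nth [::] (set_nth [::] l z [::])
        x (rev (nth [::] l z) ++ nth [::] l x))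
        y (rev (nth [::] l z) ++ nth [::] l y)).
Proof.
move=> zl xl yl /eqP zx /eqP zy /eqP xy; move e: (nth [::] l z) => w.
elim: w l zl xl yl e => [|b w IH] l zl xl yl e.
  apply: runs_nth (runs_while_nil _ zl e) _ _ => [|i].
    by sz_tac.
  by move=> _; nth_cases.
apply: (runs_le (T := (4 + (5 * size w + 1)).+1)); last by rewrite /=; lia.
pose l1 := set_nth [::] (set_nth [::] (set_nth [::] l z w) x (b :: nth [::] l x))
   y (b :: nth [::] l y).
apply: (runs_while_cons (l1 := l1)) => //; first by rewrite e.
  apply: runs_case => //; rewrite e.
  have step c : runs l (Seq (Pop z) (Seq (Push x c) (Push y c))) (1 + (1 + 1))
      (set_nth [::] (set_nth [::] (set_nth [::] l z w) x (c :: nth [::] l x))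
         y (c :: nth [::] l y)).
    apply: runs_seq (runs_pop zl) _; rewrite e /=.
    apply: runs_seq; first by apply: runs_push; sz_tac.
    apply: runs_post; first apply: runs_push.
      by sz_tac.
    by congr set_nth; [congr set_nth|]; nth_cases.
  by rewrite /l1; case: (b); exact: step.
have sz : size l1 = size l.
  by sz_tac.
apply: runs_nth (IH l1 _ _ _ _) _ _; rewrite ?sz //.
- by rewrite /l1; nth_cases.
- by sz_tac.
- by move=> i _; rewrite rev_cons !cat_rcons /l1; nth_cases.
Qed.

(** Moving to the empty stack [z] reverses the word, and moving it back onto both [x] and [y]
    restores the order. *)
Definition copy x y z := Seq (move_ x z) (move2 z x y).

Lemma runs_copy l x y z : x < size l -> y < size l -> z < size l ->
  x != y -> x != z -> y != z -> nth [::] l z = [::] ->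
  runs l (copy x y z) (9 * size (nth [::] l x) + 2)
    (set_nth [::] l y (nth [::] l x ++ nth [::] l y)).
Proof.
move=> xl yl zl xy xz yz z0.
apply: (runs_le (T := (4 * size (nth [::] l x) + 1) + (5 * size (nth [::] l x) + 1))); last lia.
apply: runs_seq (runs_move xl zl xz) _; rewrite z0 cats0.
set l1 := set_nth _ _ _ _.
have sz : size l1 = size l by sz_tac.
have z1 : nth [::] l1 z = rev (nth [::] l x) by rewrite nth_set_nth /= eqxx.
have zx : z != x by rewrite eq_sym.
have zy : z != y by rewrite eq_sym.
rewrite -size_rev -z1; apply: runs_nth; first by apply: runs_move2; rewrite ?sz.
  by sz_tac.
rewrite z1 revK; move: xy xz yz zx zy => /eqP ? /eqP ? /eqP ? /eqP ? /eqP ? i _.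
by rewrite /l1; nth_cases; rewrite ?cats0 ?z0.
Qed.

(** A loop can only test emptiness, so the flag [f] keeps it running until the closing [false] of
    [enc_nat] is read. *)
Definition read_nat x y f :=
  Seq (Push f true)
    (While f (Case x (Pop f) (Seq (Pop x) (Pop f)) (Seq (Pop x) (Push y true)))).

Lemma runs_read_nat l x y f m w : x < size l -> y < size l -> f < size l ->
  x != y -> x != f -> y != f -> nth [::] l x = enc_nat m ++ w -> nth [::] l f = [::] ->
  runs l (read_nat x y f) (4 * m + 6)
    (set_nth [::] (set_nth [::] l x w) y (unary m ++ nth [::] l y)).
Proof.
move=> xl yl fl /eqP xy /eqP xf /eqP yf ex ef.
apply: (runs_le (T := 1 + (4 * m + 5))); last lia.
apply: runs_seq (runs_push _ fl) _; rewrite ef.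
elim: m l xl yl fl ex ef => [|m IH] l xl yl fl ex ef.
  set l0 := set_nth _ _ _ _.
  have sz0 : size l0 = size l by sz_tac.
  have n0 : nth [::] l0 f = [:: true] by rewrite nth_set_nth /= eqxx.
  have x0 : nth [::] l0 x = false :: w by rewrite /l0; nth_cases.
  apply: (runs_le (T := ((1 + 1).+1 + 1).+1)) => //.
  apply: (@runs_while_cons _ (set_nth [::] (set_nth [::] l0 x w) f [::])); rewrite ?sz0 ?n0 //.
    apply: runs_case; rewrite ?sz0 ?x0 //.
    apply: runs_seq; first by apply: runs_pop; rewrite sz0.
    apply: runs_post; first by apply: runs_pop; sz_tac.
    by rewrite x0; congr set_nth; nth_cases; rewrite n0.
  apply: runs_nth; first apply: runs_while_nil.
  - by sz_tac.
  - by rewrite nth_set_nth /= eqxx.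
  - by sz_tac.
  - by move=> i _; rewrite /l0; nth_cases.
set l0 := set_nth _ _ _ _.
have sz0 : size l0 = size l by sz_tac.
have n0 : nth [::] l0 f = [:: true] by rewrite nth_set_nth /= eqxx.
have x0 : nth [::] l0 x = true :: enc_nat m ++ w by rewrite /l0; nth_cases.
pose l1 := set_nth [::] (set_nth [::] l x (enc_nat m ++ w)) y (true :: nth [::] l y).
have sz1 : size l1 = size l by sz_tac.
apply: (runs_le (T := ((1 + 1).+1 + (4 * m + 5)).+1)); last lia.
apply: (@runs_while_cons _ (set_nth [::] l1 f [:: true])); rewrite ?sz0 ?n0 //.
  apply: runs_case; rewrite ?sz0 ?x0 //.
  apply: runs_seq; first by apply: runs_pop; rewrite sz0.
  apply: runs_nth; first by apply: runs_push; sz_tac.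
    by sz_tac.
  by move=> i _; rewrite /l1 x0 /l0; nth_cases.
apply: runs_nth (IH l1 _ _ _ _ _) _ _; rewrite ?sz1 //.
- by rewrite /l1; nth_cases.
- by rewrite /l1; nth_cases.
- by sz_tac.
- have e : unary m ++ true :: nth [::] l y = unary m.+1 ++ nth [::] l y.
    by rewrite /unary; elim: (m) => //= d ->.
  by move=> i _; rewrite -e /l1; nth_cases.
Qed.

Definition push_word o (w : seq bool) := foldr (fun b c => Seq (Push o b) c) Skip w.

Lemma runs_push_word l o w : o < size l ->
  runs l (push_word o w) (size w + 1) (set_nth [::] l o (rev w ++ nth [::] l o)).
Proof.
elim: w l => [|b w IH] l ol /=.
  apply: runs_nth (@runs_skip l) _ _; first by sz_tac.
  by move=> i _; nth_cases.
apply: runs_seq (runs_push _ ol) _.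
apply: runs_nth; first by apply: IH; sz_tac.
  by sz_tac.
by move=> i _; rewrite rev_cons cat_rcons; nth_cases.
Qed.

(** Units of [p] cancel units of [q], and the excess goes to [r]. Both truncated differences result,
    which decides the order of two numbers and yields their distance. *)
Definition sub_ p q r := for_ p (Case q (Push r true) (Pop q) (Pop q)).

Lemma behead_unary m : behead (unary m) = unary m.-1.
Proof. by case: m. Qed.

Lemma runs_sub l p q r a b c : p < size l -> q < size l -> r < size l ->
  p != q -> p != r -> q != r ->
  nth [::] l p = unary a -> nth [::] l q = unary b -> nth [::] l r = unary c ->
  runs l (sub_ p q r) (4 * a + 1)
    (set_nth [::] (set_nth [::] (set_nth [::] l p [::]) q (unary (b - a)))
       r (unary (a - b + c))).
Proof.
move=> pl ql rl /eqP pq /eqP pr /eqP qr ep eq er.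
pose tau i := set_nth [::] (set_nth [::] (set_nth [::] l p (unary i))
   q (unary (b - (a - i)))) r (unary (a - i - b + c)).
have sz i : size (tau i) = size l.
  by sz_tac.
apply: (runs_le (T := a * (2 + 2) + 1)); last lia.
have run : runs (tau a) (sub_ p q r) (a * (2 + 2) + 1) (tau 0).
  apply: runs_for; rewrite ?sz //; last by rewrite /tau; nth_cases.
  move=> i ia; rewrite sz; split=> //; first by rewrite /tau; nth_cases.
  set l1 := set_nth _ _ _ _.
  have sz1 : size l1 = size l by sz_tac.
  apply: runs_case; rewrite ?sz1 //.
  have q1 : nth [::] l1 q = unary (b - (a - i.+1)) by rewrite /l1 /tau; nth_cases.
  have [le|lt] := leqP b (a - i.+1).
    have e0 : b - (a - i.+1) = 0 by lia.
    rewrite q1 e0; apply: runs_nth; first by apply: runs_push; rewrite sz1.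
      by sz_tac.
    move=> x _; rewrite /l1 /tau (_ : a - i - b = (a - i.+1 - b).+1); last lia.
    by rewrite e0 (_ : b - (a - i) = 0); [nth_cases | lia].
  have -> : nth [::] l1 q = true :: unary (b - (a - i)).
    by rewrite q1 (_ : b - (a - i.+1) = (b - (a - i)).+1) //; lia.
  apply: runs_nth; first by apply: runs_pop; rewrite sz1.
    by sz_tac.
  move=> x _; rewrite q1 behead_unary (_ : (b - (a - i.+1)).-1 = b - (a - i)); last lia.
  by rewrite /l1 /tau (_ : a - i - b = a - i.+1 - b); [nth_cases | lia].
move=> s hs; have hs' : holds (tau a) s.
  apply: holds_nth hs; rewrite ?sz // => i _; rewrite /tau subnn subn0 add0n.
  by nth_cases.
have [t [s' [e tT h]]] := run s hs'; exists t, s'; split=> //.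
by rewrite /tau !subn0 in h.
Qed.

Definition dist_ x y r p q z :=
  Seq (copy x p z) (Seq (copy y q z) (Seq (sub_ p q r) (move_ q r))).

Definition adist a b := (b - a) + (a - b).

Lemma rev_unary m : rev (unary m) = unary m.
Proof. exact: rev_nseq. Qed.

Lemma runs_dist l x y r p q z a b :
  all (fun v => v < size l) [:: x; y; r; p; q; z] ->
  uniq [:: x; r; p; q; z] -> uniq [:: y; r; p; q; z] ->
  nth [::] l x = unary a -> nth [::] l y = unary b ->
  nth [::] l r = [::] -> nth [::] l p = [::] -> nth [::] l q = [::] -> nth [::] l z = [::] ->
  runs l (dist_ x y r p q z) (13 * (a + b) + 6) (set_nth [::] l r (unary (adist a b))).
Proof.
case/and5P=> xl yl rl pl /andP[ql /andP[zl _]].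
rewrite /= !inE !negb_or -!andbA => /and5P[xr xp xq xz /and5P[rp rq rz pq /and3P[pz qz _]]].
move=> /and5P[yr yp yq yz _] ex ey er ep eq ez.
have xz' : z != x by rewrite eq_sym.
have yz' : z != y by rewrite eq_sym.
apply: (runs_le (T := (9 * a + 2) + ((9 * b + 2) + ((4 * a + 1) + (4 * b + 1))))); last lia.
move: (xr) (xp) (xq) (xz) (yr) (yp) (yq) (yz) (rp) (rq) (rz) (pq) (pz) (qz) =>
  /eqP ? /eqP ? /eqP ? /eqP ? /eqP ? /eqP ? /eqP ? /eqP ? /eqP ? /eqP ? /eqP ? /eqP ? /eqP ? /eqP ?.
have := runs_copy xl pl zl xp xz pz ez.
rewrite ex ep cats0 size_nseq => h1; apply: runs_seq h1 _.
set l1 := set_nth _ _ _ _; have s1 : size l1 = size l by rewrite size_set_nth (maxn_idPr pl).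
have [y1 q1 z1] : [/\ nth [::] l1 y = unary b, nth [::] l1 q = [::] & nth [::] l1 z = [::]].
  by rewrite /l1; split; nth_cases.
have := @runs_copy l1 y q z; rewrite s1 => /(_ yl ql zl yq yz qz z1).
rewrite y1 q1 cats0 size_nseq => h2; apply: runs_seq h2 _.
set l2 := set_nth _ _ _ _; have s2 : size l2 = size l by rewrite size_set_nth s1 (maxn_idPr ql).
have [p2 q2 r2] : [/\ nth [::] l2 p = unary a, nth [::] l2 q = unary b & nth [::] l2 r = unary 0].
  by rewrite /l2 /l1; split; nth_cases.
have pr : p != r by rewrite eq_sym.
have qr : q != r by rewrite eq_sym.
have := @runs_sub l2 p q r a b 0; rewrite s2 => /(_ pl ql rl pq pr qr p2 q2 r2).
move=> h3; apply: runs_seq h3 _; rewrite addn0.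
set l3 := set_nth _ _ _ _; have s3 : size l3 = size l.
  by rewrite 3!size_set_nth s2 (maxn_idPr pl) (maxn_idPr ql) (maxn_idPr rl).
have [q3 r3] : nth [::] l3 q = unary (b - a) /\ nth [::] l3 r = unary (a - b).
  by rewrite /l3 /l2; split; nth_cases.
have := @runs_move l3 q r; rewrite s3 => /(_ ql rl qr); rewrite q3 r3 size_nseq rev_unary.
move=> h4; apply: (runs_le (T := 4 * (b - a) + 1)); last by rewrite leq_add2r leq_mul2l leq_subr.
apply: runs_nth h4 _ _.
  by rewrite 3!size_set_nth s3 (maxn_idPr ql) (maxn_idPr rl).
move=> i _; rewrite /l3 /l2 /l1 /adist; nth_cases.
by rewrite /unary nseqD.
Qed.

(** * Listing the cells *)

(** The invariant shared by the four nested loops. Since the counter decreases, the bits of the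
    largest index lie on top of the input, and each output goes in front of those already
    produced. *)
Lemma runs_collect (St : nat -> seq bool -> seq cell -> nat -> seq (seq bool)) x c T m d
    (bits : nat -> seq bool) (out : nat -> seq cell) :
  (forall i Y l q, x < size (St i Y l q)) ->
  (forall i Y l q, nth [::] (St i Y l q) x = unary i) ->
  (forall i Y l q, set_nth [::] (St i.+1 Y l q) x (unary i) = St i Y l q) ->
  (forall i Y l q, i < m ->
     runs (St i (rev (bits i) ++ Y) l q) c T (St i Y (out i ++ l) (d + q))) ->
  forall Y l q, runs (St m (rev (upto bits m) ++ Y) l q) (for_ x c) (m * (T + 2) + 1)
    (St 0 Y (upto out m ++ l) (m * d + q)).
Proof.
move=> sz nx sx body Y l q.
pose tau i := St i (rev (upto bits i) ++ Y)
  (flatten [seq out y | y <- iota i (m - i)] ++ l) ((m - i) * d + q).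
have -> : St m (rev (upto bits m) ++ Y) l q = tau m by rewrite /tau subnn.
have -> : St 0 Y (upto out m ++ l) (m * d + q) = tau 0 by rewrite /tau subn0.
apply: runs_for; rewrite ?sz ?nx // => i im; rewrite sz nx sx; split=> //.
rewrite /tau uptoS rev_cat -catA (_ : m - i = (m - i.+1).+1); last lia.
by rewrite /= -catA mulSn -addnA; apply: body.
Qed.

Definition enc_cell (c : cell) : seq bool :=
  let: (i, j, a, b) := c in enc_nat i ++ enc_nat j ++ enc_nat a ++ enc_nat b.

Definition enc_cells (l : seq cell) : seq bool := flatten [seq enc_cell c | c <- l].

Ltac side := first [exact isT | reflexivity | idtac].
Tactic Notation "step" open_constr(lem) :=
  eapply runs_seq; [eapply lem; side | cbn [nth set_nth behead]; rewrite ?cats0 ?addn0].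
Tactic Notation "final" open_constr(lem) :=
  eapply runs_post; [eapply lem; side | cbn [nth set_nth behead]; rewrite ?cats0 ?addn0].

(* Stacks of the generation phase: 0 input, 1 k, 2 n, 3 scratch, 4 flag,
   5 reversed relation bits, 6-9 loop counters i j a b, 10 cells,
   11 their number, 12 new parameter, 13-16 scratch. *)
Definition gen_state k n i j a b (Y : seq bool) (l : seq cell) q
    (u v w : seq bool) : seq (seq bool) :=
  [:: [::]; unary k; unary n; [::]; [::]; Y; unary i; unary j; unary a; unary b;
      enc_cells l; unary (size l); unary q; [::]; u; v; w;
      [::]; [::]; [::]; [::]; [::]; [::]; [::]; [::]].

(** The code is pushed back to front, each terminator before its unary block, so that it reads [i],
    [j], [a], [b] from the top. *)
Definition push_cell : cmd :=
  Seq (Push 11 true)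
 (Seq (Push 10 false) (Seq (copy 9 10 3)
 (Seq (Push 10 false) (Seq (copy 8 10 3)
 (Seq (Push 10 false) (Seq (copy 7 10 3)
 (Seq (Push 10 false) (copy 6 10 3)))))))).

Lemma enc_natE m w : enc_nat m ++ w = unary m ++ false :: w.
Proof. by rewrite /enc_nat cat_rcons. Qed.

Lemma runs_push_cell k n i j a b Y l q u v w :
  runs (gen_state k n i j a b Y l q u v w) push_cell (9 * (i + j + a + b) + 13)
       (gen_state k n i j a b Y ((i, j, a, b) :: l) q u v w).
Proof.
eapply runs_le.
  rewrite /gen_state /push_cell.
  step runs_push. step runs_push. step runs_copy. step runs_push. step runs_copy.
  step runs_push. step runs_copy. step runs_push. final runs_copy.
  by rewrite /enc_cells /= -!catA !enc_natE.
by rewrite /= !size_nseq; lia.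
Qed.

Definition push_dummy : cmd :=
  Seq (Push 11 true)
 (Seq (Push 10 false) (Seq (Push 10 false) (Seq (Push 10 false) (Seq (Push 10 false)
 (Seq (copy 1 10 3) (Push 10 true)))))).

Lemma runs_push_dummy k n i j a b Y l q u v w :
  runs (gen_state k n i j a b Y l q u v w) push_dummy (9 * k + 8)
       (gen_state k n i j a b Y (dummy k :: l) q u v w).
Proof.
eapply runs_le.
  rewrite /gen_state /push_dummy.
  step runs_push. step runs_push. step runs_push. step runs_push. step runs_push.
  step runs_copy. final runs_push.
  by rewrite /enc_cells /= -!catA !enc_natE.
by rewrite /= !size_nseq; lia.
Qed.

(** Stacks 14 and 15 receive [j - i] and [i - j], which separate the three cases of [keep]. Only for
    [i < j] is a relation bit consumed. *)
Definition cell_body : cmd :=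
  Seq (copy 6 13 3) (Seq (copy 7 14 3) (Seq (sub_ 13 14 15)
 (Seq (Case 14
   (Case 15
      (Seq (dist_ 8 9 16 13 14 3) (Seq (Case 16 push_cell Skip Skip) (clear 16)))
      push_cell push_cell)
   (Case 5 Skip (Pop 5) (Seq (Pop 5) push_cell))
   (Case 5 Skip (Pop 5) (Seq (Pop 5) push_cell)))
 (Seq (clear 14) (clear 15))))).

Section Generation.
Variables (ok : nat -> nat -> nat -> nat -> bool) (k n M : nat).
Hypotheses (kM : k <= M) (nM : n <= M).

Definition bit i j a b : seq bool := if i < j then [:: ok i j a b] else [::].
Definition kept i j a b : seq cell := if keep ok i j a b then [:: (i, j, a, b)] else [::].

Lemma runs_push_cell_le i j a b Y l q u v w :
  i <= M -> j <= M -> a <= M -> b <= M ->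
  runs (gen_state k n i j a b Y l q u v w) push_cell (36 * M + 13)
       (gen_state k n i j a b Y ((i, j, a, b) :: l) q u v w).
Proof. by move=> *; apply: runs_le; [exact: runs_push_cell | lia]. Qed.

Lemma runs_cell_body i j a b Y l q : i <= M -> j <= M -> a <= M -> b <= M ->
  runs (gen_state k n i j a b (rev (bit i j a b) ++ Y) l q [::] [::] [::]) cell_body
       (100 * M + 100)
       (gen_state k n i j a b Y (kept i j a b ++ l) q [::] [::] [::]).
Proof.
move=> iM jM aM bM.
eapply runs_le.
  rewrite {1}/gen_state /cell_body.
  step runs_copy. step runs_copy.
  step (runs_sub (p := 13) (q := 14) (r := 15) (a := i) (b := j) (c := 0)).
  eapply (@runs_seq _ (gen_state k n i j a b Y (kept i j a b ++ l) q
       (unary (j - i)) (unary (i - j)) [::])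
     _ _ _ (70 * M + 60)); last first.
    rewrite /gen_state; step runs_clear. final runs_clear.
    by [].
  rewrite /bit /kept /keep; case: ltngtP => [ij|ji|<-].
  - have -> : j - i = (j - i.+1).+1 by lia.
    eapply runs_le.
      eapply runs_case; first by []. cbn [nth unary nseq ncons iter].
      eapply runs_case; first by []. cbn [nth rev catrev cat].
      instantiate (1 := 36 * M + 14); case: (ok i j a b).
        by eapply runs_le; [step runs_pop; exact: runs_push_cell_le|lia].
      by eapply runs_le; [final runs_pop|lia].
    lia.
  - have -> : i - j = (i - j.+1).+1 by lia.
    have -> : j - i = 0 by lia.
    eapply runs_le.
      eapply runs_case; first by []. cbn [nth unary nseq ncons iter].
      eapply runs_case; first by []. cbn [nth].
      exact: runs_push_cell_le.
    lia.
  - rewrite subnn; eapply runs_le.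
      eapply runs_case; first by []. cbn [nth unary nseq ncons iter].
      eapply runs_case; first by []. cbn [nth].
      step (runs_dist (x := 8) (y := 9) (a := a) (b := b)).
      eapply (@runs_seq _ (gen_state k n i i a b Y
          ((if a == b then [:: (i, i, a, b)] else [::]) ++ l) q [::] [::] (unary (adist a b)))
          _ _ _ (36 * M + 20)).
        eapply runs_le.
          eapply runs_case; first by []. cbn [nth].
          instantiate (1 := 36 * M + 13); rewrite /adist; case: eqVneq => [->|ab].
            by rewrite subnn; exact: runs_push_cell_le.
          have -> : b - a + (a - b) = (b - a + (a - b)).-1.+1 by lia.
          by eapply runs_le; [exact: runs_skip|lia].
        lia.
      by rewrite /gen_state; final runs_clear.
    rewrite /= !size_nseq /adist; lia.
rewrite /= !size_nseq; lia.
Qed.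

(* A loop counter, being popped first, is the index of the current round, so
   indices decrease: the relation bits have to be reversed beforehand, and the
   cells end up stacked in increasing order. *)
Definition loop_b : cmd := Seq (copy 2 9 3) (for_ 9 cell_body).
Definition loop_a : cmd := Seq (copy 2 8 3) (for_ 8 loop_b).
Definition slot_body : cmd := Seq loop_a (Seq push_dummy (Push 12 true)).
Definition loop_j : cmd := Seq (copy 1 7 3) (for_ 7 slot_body).
Definition loop_i : cmd := Seq (copy 1 6 3) (for_ 6 loop_j).

Definition time_b := 9 * M + 2 + (M * (100 * M + 100 + 2) + 1).
Definition time_a := 9 * M + 2 + (M * (time_b + 2) + 1).
Definition time_slot := time_a + (9 * M + 8 + 1).
Definition time_j := 9 * M + 2 + (M * (time_slot + 2) + 1).
Definition time_i := 9 * M + 2 + (M * (time_j + 2) + 1).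

Lemma runs_loop_b i j a Y l q : i <= M -> j <= M -> a <= M ->
  runs (gen_state k n i j a 0 (rev (upto (bit i j a) n) ++ Y) l q [::] [::] [::]) loop_b
       time_b
       (gen_state k n i j a 0 Y (upto (kept i j a) n ++ l) q [::] [::] [::]).
Proof.
move=> iM jM aM; eapply runs_le.
  rewrite {1}/gen_state /loop_b; step runs_copy.
  eapply runs_post.
    apply: (@runs_collect (fun c Y l q => gen_state k n i j a c Y l q [::] [::] [::])
      9 cell_body _ n 0) => // c Y' l' q' cn.
    by apply: runs_cell_body; rewrite // (leq_trans (ltnW cn)).
    by rewrite muln0.
by rewrite /= size_nseq leq_add // ?leq_add2r ?leq_mul // leq_add2r leq_mul.
Qed.

Lemma runs_loop_a i j Y l q : i <= M -> j <= M ->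
  runs (gen_state k n i j 0 0 (rev (upto (fun a => upto (bit i j a) n) n) ++ Y) l q
          [::] [::] [::]) loop_a
       time_a
       (gen_state k n i j 0 0 Y (slot_cells ok n i j ++ l) q [::] [::] [::]).
Proof.
move=> iM jM; eapply runs_le.
  rewrite {1}/gen_state /loop_a; step runs_copy.
  eapply runs_post.
    apply: (@runs_collect (fun c Y l q => gen_state k n i j c 0 Y l q [::] [::] [::])
      8 loop_b _ n 0) => // c Y' l' q' cn.
    by apply: runs_loop_b; rewrite // (leq_trans (ltnW cn)).
    by rewrite muln0.
by rewrite /= size_nseq leq_add // ?leq_add2r ?leq_mul // leq_add2r leq_mul.
Qed.

Lemma runs_slot_body i j Y l q : i <= M -> j <= M ->
  runs (gen_state k n i j 0 0 (rev (upto (fun a => upto (bit i j a) n) n) ++ Y) l q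
          [::] [::] [::]) slot_body
       time_slot
       (gen_state k n i j 0 0 Y ((dummy k :: slot_cells ok n i j) ++ l) q.+1 [::] [::] [::]).
Proof.
move=> iM jM; eapply runs_le.
  eapply runs_seq; first exact: runs_loop_a.
  eapply runs_seq; first exact: runs_push_dummy.
  by rewrite /gen_state; final runs_push.
by rewrite /time_slot; lia.
Qed.

Lemma runs_loop_j i Y l q : i <= M ->
  runs (gen_state k n i 0 0 0
          (rev (upto (fun j => upto (fun a => upto (bit i j a) n) n) k) ++ Y) l q
          [::] [::] [::]) loop_j
       time_j
       (gen_state k n i 0 0 0 Y (upto (fun j => dummy k :: slot_cells ok n i j) k ++ l) (k + q)
          [::] [::] [::]).
Proof.
move=> iM; eapply runs_le.
  rewrite {1}/gen_state /loop_j; step runs_copy.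
  rewrite -[k in k + q]muln1.
  apply: (@runs_collect (fun c Y l q => gen_state k n i c 0 0 Y l q [::] [::] [::])
    7 slot_body _ k 1) => // c Y' l' q' ck.
  by apply: runs_slot_body; rewrite // (leq_trans (ltnW ck)).
by rewrite /= size_nseq leq_add // ?leq_add2r ?leq_mul // leq_add2r leq_mul.
Qed.

Definition all_bits : seq bool :=
  upto (fun i => upto (fun j => upto (fun a => upto (bit i j a) n) n) k) k.

Lemma runs_loop_i l q :
  runs (gen_state k n 0 0 0 0 (rev all_bits) l q [::] [::] [::]) loop_i time_i
       (gen_state k n 0 0 0 0 [::]
          (upto (fun i => upto (fun j => dummy k :: slot_cells ok n i j) k) k ++ l) (k * k + q)
          [::] [::] [::]).
Proof.
eapply runs_le.
  rewrite {1}/gen_state /loop_i; step runs_copy.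
  rewrite -[rev all_bits]cats0.
  apply: (@runs_collect (fun c Y l q => gen_state k n c 0 0 0 Y l q [::] [::] [::])
    6 loop_j _ k k) => // c Y' l' q' ck.
  by apply: runs_loop_j; rewrite // (leq_trans (ltnW ck)).
by rewrite /= size_nseq leq_add // ?leq_add2r ?leq_mul // leq_add2r leq_mul.
Qed.

End Generation.

(** * Writing the matrix *)

(** Only the entries 0, 1/8, 1/2, 3/4 and 1 occur, so their codes are constants of the program and
    it never computes with rationals. *)
Definition entry_word (e : nat) : seq bool := enc_rat (e%:R / 8)%R.

(* Stacks of the output phase: as in gen_state, with the row cell in 6-9, the
   output in 11, distances in 15-18, the rows and columns still to be treated
   in 19 and 20, and the column cell in 21-24. *)
Definition out_state k n q i j a b L O (r1 r2 r3 r4 : nat) L1 L2 i' j' a' b' : seq (seq bool) :=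
  [:: [::]; unary k; unary n; [::]; [::]; [::]; unary i; unary j; unary a; unary b;
      L; O; unary q; [::]; [::]; unary r1; unary r2; unary r3; unary r4; L1; L2;
      unary i'; unary j'; unary a'; unary b'].

Definition push_entry (e : nat) : cmd := push_word 11 (entry_word e).

(** A decision tree on the distances of rows, columns and the two labels; distance 1 is recognised
    by a pop followed by an emptiness test. *)
Definition pick_entry : cmd :=
  let onzero x c d := Case x c d d in
  onzero 15
    (onzero 16
       (onzero 17 (onzero 18 (push_entry 8) (push_entry 6))
                  (onzero 18 (push_entry 6) (push_entry 4)))
       (Seq (Pop 16) (onzero 16 (onzero 17 (push_entry 0) (push_entry 1)) (push_entry 0))))
    (Seq (Pop 15) (onzero 15 (onzero 16 (onzero 18 (push_entry 0) (push_entry 1)) (push_entry 0))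
                             (push_entry 0))).

Definition entry_of (d1 d2 d3 d4 : nat) : nat :=
  if d1 == 0 then
    if d2 == 0 then
      if d3 == 0 then if d4 == 0 then 8 else 6 else if d4 == 0 then 6 else 4
    else if d2 == 1 then nat_of_bool (d3 != 0) else 0
  else if (d1 == 1) && (d2 == 0) then nat_of_bool (d4 != 0) else 0.

Lemma entry_ofE i j a b i' j' a' b' :
  entry_of (adist i i') (adist j j') (adist a a') (adist b b') =
  ip (i, j, a, b) (i', j', a', b').
Proof.
have d0 x y : (adist x y == 0) = (x == y) by rewrite /adist; apply/idP/idP; lia.
have d1 x y : (adist x y == 1) = (x == y.+1) || (y == x.+1).
  by rewrite /adist; apply/idP/idP; lia.
rewrite /entry_of !d0 !d1 /ip /link.
have [->|_] := eqVneq i i'; have [->|_] := eqVneq j j';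
  rewrite ?(ltn_eqF (ltnSn _)) ?orbF ?muln0 ?mul1n ?addn0 ?add0n ?mul0n ?andbF ?andbT //.
- by case: (a == a'); case: (b == b').
- by case: ifP; rewrite ?mul1n.
- by case: ifP; rewrite ?mul1n.
Qed.

Definition entry_cost := size (entry_word 0) + size (entry_word 1) + size (entry_word 4)
  + size (entry_word 6) + size (entry_word 8).

Ltac reduce_cmd :=
  match goal with |- runs ?l ?c ?T ?l' =>
    let c' := eval cbn [out_state nth unary nseq ncons iter] in c in change (runs l c' T l')
  end.

Lemma size_entry_word e : e \in [:: 0; 1; 4; 6; 8] -> size (entry_word e) <= entry_cost.
Proof. by rewrite !inE /entry_cost => /or4P[|||/orP[]] /eqP->; lia. Qed.

Lemma mem_entry_of d1 d2 d3 d4 : entry_of d1 d2 d3 d4 \in [:: 0; 1; 4; 6; 8].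
Proof. by rewrite /entry_of; do ?case: ifP => // _; case: (_ != _). Qed.

(* Simplification would otherwise evaluate the rational number. *)
Arguments entry_word : simpl never.

Section Output.
Variables (k n q M : nat) (cs : seq cell).
Definition small (c : cell) : bool :=
  let: (i, j, a, b) := c in [&& i <= M, j <= M, a <= M & b <= M].
Hypothesis csM : all small cs.

Let L := enc_cells cs.

Lemma runs_push_entry e i j a b O r1 r2 r3 r4 L1 L2 i' j' a' b' :
  size (entry_word e) <= entry_cost ->
  runs (out_state k n q i j a b L O r1 r2 r3 r4 L1 L2 i' j' a' b') (push_entry e)
    (entry_cost + 1)
    (out_state k n q i j a b L (rev (entry_word e) ++ O) r1 r2 r3 r4 L1 L2 i' j' a' b').
Proof. by move=> le; eapply runs_le; [rewrite /out_state; final runs_push_word | lia]. Qed.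

(** The predecessors in the final state record the pops made by these tests; the caller clears the
    distances afterwards. *)
Lemma runs_pick_entry i j a b O r1 r2 r3 r4 L1 L2 i' j' a' b' :
  runs (out_state k n q i j a b L O r1 r2 r3 r4 L1 L2 i' j' a' b') pick_entry
    (entry_cost + 10)
    (out_state k n q i j a b L (rev (entry_word (entry_of r1 r2 r3 r4)) ++ O)
       r1.-1 (if r1 == 0 then r2.-1 else r2) r3 r4 L1 L2 i' j' a' b').
Proof.
have pe e O' r1' r2' r3' r4' : e \in [:: 0; 1; 4; 6; 8] ->
  runs (out_state k n q i j a b L O' r1' r2' r3' r4' L1 L2 i' j' a' b') (push_entry e)
    (entry_cost + 1)
    (out_state k n q i j a b L (rev (entry_word e) ++ O') r1' r2' r3' r4' L1 L2 i' j' a' b').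
  by move=> /size_entry_word; apply: runs_push_entry.
rewrite /pick_entry; case: r1 => [|r1].
  apply: (runs_le (T := (entry_cost + 5).+1)); last lia.
  apply: runs_case_nil => //; reduce_cmd.
  apply: (runs_le (T := (entry_cost + 4).+1)); last lia.
  apply: runs_case_nil => //; case: r2 => [|r2]; reduce_cmd.
    apply: (runs_le (T := (entry_cost + 1).+2)); last lia.
    apply: runs_case_nil => //; case: r3 => [|r3]; reduce_cmd;
    by apply: runs_case_nil => //; case: r4 => [|r4]; reduce_cmd; apply: pe.
  apply: (runs_le (T := 1 + (entry_cost + 1).+2)); last lia.
  apply: (runs_seq (l1 := out_state k n q i j a b L O 0 r2 r3 r4 L1 L2 i' j' a' b')).
    by rewrite /out_state; final runs_pop.
  apply: runs_case_nil => //; case: r2 => [|r2]; reduce_cmd.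
    by apply: runs_case_nil => //; case: r3 => [|r3]; reduce_cmd; apply: pe.
  by apply: (runs_le (T := entry_cost + 1)); [apply: pe | lia].
apply: (runs_le (T := (1 + (entry_cost + 1).+3).+1)); last lia.
apply: runs_case_nil => //; reduce_cmd.
apply: (runs_seq (l1 := out_state k n q i j a b L O r1 r2 r3 r4 L1 L2 i' j' a' b')).
  by rewrite /out_state; final runs_pop.
apply: runs_case_nil => //; case: r1 => [|r1]; reduce_cmd.
  apply: runs_case_nil => //; case: r2 => [|r2]; reduce_cmd.
    by apply: runs_case_nil => //; case: r4 => [|r4]; reduce_cmd; apply: pe.
  by apply: (runs_le (T := entry_cost + 1)); [apply: pe | lia].
by apply: (runs_le (T := entry_cost + 1)); [apply: pe | lia].
Qed.

Definition read_cell s i j a b : cmd :=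
  Seq (read_nat s i 4) (Seq (read_nat s j 4) (Seq (read_nat s a 4) (read_nat s b 4))).

Definition clear4 i j a b : cmd := Seq (clear i) (Seq (clear j) (Seq (clear a) (clear b))).

Definition out_entry : cmd :=
  Seq (read_cell 20 21 22 23 24)
 (Seq (dist_ 6 21 15 13 14 3) (Seq (dist_ 7 22 16 13 14 3)
 (Seq (dist_ 8 23 17 13 14 3) (Seq (dist_ 9 24 18 13 14 3)
 (Seq pick_entry (Seq (clear4 15 16 17 18) (clear4 21 22 23 24))))))).

Lemma enc_cells_cons i j a b r : enc_cells ((i, j, a, b) :: r) =
  enc_nat i ++ enc_nat j ++ enc_nat a ++ enc_nat b ++ enc_cells r.
Proof. by rewrite /enc_cells /= -!catA. Qed.

Definition time_entry := entry_cost + 200 * M + 100.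

Lemma runs_out_entry i j a b i' j' a' b' O L1 r :
  small (i, j, a, b) -> small (i', j', a', b') ->
  runs (out_state k n q i j a b L O 0 0 0 0 L1 (enc_cells ((i', j', a', b') :: r)) 0 0 0 0)
    out_entry time_entry
    (out_state k n q i j a b L (rev (entry_word (ip (i, j, a, b) (i', j', a', b'))) ++ O)
      0 0 0 0 L1 (enc_cells r) 0 0 0 0).
Proof.
move=> /and4P[iM jM aM bM] /and4P[iM' jM' aM' bM']; eapply runs_le.
  rewrite {1}/out_state enc_cells_cons.
  eapply runs_seq.
    step runs_read_nat. step runs_read_nat. step runs_read_nat. final runs_read_nat.
    reflexivity.
  rewrite ?cats0.
  step (runs_dist (x := 6) (y := 21) (a := i) (b := i')).
  step (runs_dist (x := 7) (y := 22) (a := j) (b := j')).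
  step (runs_dist (x := 8) (y := 23) (a := a) (b := a')).
  step (runs_dist (x := 9) (y := 24) (a := b) (b := b')).
  eapply runs_seq; first exact: (@runs_pick_entry i j a b).
  rewrite entry_ofE {1}/out_state.
  eapply runs_seq.
    step runs_clear. step runs_clear. step runs_clear. final runs_clear.
    reflexivity.
  step runs_clear. step runs_clear. step runs_clear. final runs_clear.
  reflexivity.
rewrite /= !size_nseq /time_entry /adist.
case: ifP => _; lia.
Qed.

Definition row_word (u : cell) : seq bool := flatten [seq entry_word (ip u v) | v <- cs].

(** Reading consumes the list of columns, so every row starts from a fresh copy of stack 10. *)
Definition out_row : cmd :=
  Seq (read_cell 19 6 7 8 9) (Seq (copy 10 20 3) (Seq (While 20 out_entry) (clear4 6 7 8 9))).

Definition time_row :=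
  30 * M + 100 + 9 * size L + (size cs * time_entry.+1 + 1).

Lemma runs_out_row i j a b O r : small (i, j, a, b) ->
  runs (out_state k n q 0 0 0 0 L O 0 0 0 0 (enc_cells ((i, j, a, b) :: r)) [::] 0 0 0 0)
    out_row time_row
    (out_state k n q 0 0 0 0 L (rev (row_word (i, j, a, b)) ++ O) 0 0 0 0 (enc_cells r) [::]
       0 0 0 0).
Proof.
move=> sm; have /and4P[iM jM aM bM] := sm; eapply runs_le.
  rewrite {1}/out_state enc_cells_cons.
  eapply runs_seq.
    step runs_read_nat. step runs_read_nat. step runs_read_nat. final runs_read_nat.
    reflexivity.
  rewrite ?cats0; step runs_copy.
  eapply (@runs_seq _ (out_state k n q i j a b L (rev (row_word (i, j, a, b)) ++ O)
    0 0 0 0 (enc_cells r) [::] 0 0 0 0)).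
    apply: (runs_each (sigma := fun d r' => out_state k n q i j a b L
      (rev (flatten [seq entry_word (ip (i, j, a, b) v) | v <- d]) ++ O) 0 0 0 0 (enc_cells r)
      (enc_cells r') 0 0 0 0)) => // d [[[i' j'] a'] b'] r' ecs; split=> //.
      by rewrite /= enc_cells_cons; case: (i').
    rewrite map_rcons flatten_rcons rev_cat -catA; apply: runs_out_entry => //.
    by move: csM; rewrite ecs all_cat => /andP[_ /andP[]].
  rewrite {1}/out_state; step runs_clear. step runs_clear. step runs_clear. final runs_clear.
  reflexivity.
by rewrite /= !size_nseq /time_row; lia.
Qed.

Definition out_matrix : cmd := Seq (copy 10 19 3) (While 19 out_row).

Definition matrix_word : seq bool := flatten [seq row_word u | u <- cs].

Definition time_matrix := 9 * size L + 2 + (size cs * time_row.+1 + 1).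

Lemma runs_out_matrix O :
  runs (out_state k n q 0 0 0 0 L O 0 0 0 0 [::] [::] 0 0 0 0) out_matrix time_matrix
    (out_state k n q 0 0 0 0 L (rev matrix_word ++ O) 0 0 0 0 [::] [::] 0 0 0 0).
Proof.
rewrite {1}/out_state /out_matrix; step runs_copy.
apply: (runs_each (sigma := fun d r' => out_state k n q 0 0 0 0 L
   (rev (flatten [seq row_word v | v <- d]) ++ O) 0 0 0 0 (enc_cells r') [::] 0 0 0 0))
  => // d [[[i j] a] b] r ecs; split=> //.
  by rewrite /= enc_cells_cons; case: (i).
rewrite map_rcons flatten_rcons rev_cat -catA; apply: runs_out_row.
by move: csM; rewrite ecs all_cat => /andP[_ /andP[]].
Qed.

End Output.

(** * The complete program and its time bound *)

Definition clear_list (xs : seq nat) : cmd := foldr (fun x c => Seq (clear x) c) Skip xs.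

Lemma runs_clear_list l xs S : all (fun x => x < size l) xs ->
  all (fun v => size v <= S) l ->
  runs l (clear_list xs) (size xs * (2 * S + 1) + 1)
    (mkseq (fun i => if i \in xs then [::] else nth [::] l i) (size l)).
Proof.
elim: xs l => [|x xs IH] l /=.
  move=> _ _; apply: runs_post; first exact: runs_skip.
  by rewrite -[LHS](mkseq_nth [::]).
case/andP=> xl xsl lS.
apply: (runs_le (T := (2 * S + 1) + (size xs * (2 * S + 1) + 1))); last by rewrite mulSn addnA.
apply: (@runs_seq _ (set_nth [::] l x [::])).
  apply: runs_le (runs_clear xl) _; rewrite leq_add2r leq_mul2l /=.
  by move/allP: lS; apply; rewrite mem_nth.
have sz : size (set_nth [::] l x [::]) = size l by rewrite size_set_nth (maxn_idPr xl).
apply: runs_post; first apply: IH; rewrite ?sz //.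
  apply/(all_nthP [::]) => i; rewrite sz nth_set_nth /= => il.
  by case: eqP => // _; move/(all_nthP [::]): lS; apply.
apply/eq_in_map => i _; rewrite inE nth_set_nth /=.
by case: eqP => //=; case: ifP.
Qed.

Lemma size_flatten_le (A : eqType) T (f : A -> seq T) d s :
  {in s, forall x, size (f x) <= d} -> size (flatten [seq f x | x <- s]) <= size s * d.
Proof.
elim: s => //= x s IH h; rewrite size_cat mulSn leq_add ?h ?mem_head //.
by apply: IH => y ys; apply: h; rewrite inE ys orbT.
Qed.

Lemma size_upto_le T (f : nat -> seq T) d m :
  (forall x, x < m -> size (f x) <= d) -> size (upto f m) <= m * d.
Proof.
move=> h; rewrite -[m in m * _](size_iota 0); apply: size_flatten_le => x.
by rewrite mem_iota => /h.
Qed.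

Lemma size_cells_le ok k n : size (cells ok k n) <= k * (k * (n * n + 1)) + 1.
Proof.
rewrite size_cat leq_add2r; apply: size_upto_le => i _; apply: size_upto_le => j _ /=.
rewrite addn1 ltnS; apply: size_upto_le => a _.
rewrite -[leqRHS]muln1; apply: size_upto_le => b _.
by case: ifP.
Qed.

Lemma cells_small ok k n M : k < M -> n <= M -> all (small M) (cells ok k n).
Proof.
move=> kM nM; apply/allP => c /mem_cells h; have [->|/h] := eqVneq c (dummy k).
  by rewrite /= kM.
move=> [i [j [a [b [[-> ik jk an bn] _]]]]].
by apply/and4P; split; lia.
Qed.

Lemma size_enc_nat m : size (enc_nat m) = m.+1.
Proof. by rewrite size_rcons size_nseq. Qed.

Lemma size_enc_cells M cs : all (small M) cs -> size (enc_cells cs) <= size cs * (4 * M + 4).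
Proof.
elim: cs => // [[[[i j] a] b] cs] IH /= /andP[/and4P[iM jM aM bM] /IH le].
rewrite enc_cells_cons !size_cat !size_enc_nat mulSn; lia.
Qed.

Lemma size_matrix_word cs : size (matrix_word cs) <= size cs * (size cs * entry_cost).
Proof.
have ec u v : size (entry_word (ip u v)) <= entry_cost.
  by case: u v => [[[? ?] ?] ?] [[[? ?] ?] ?]; rewrite -entry_ofE size_entry_word ?mem_entry_of.
by do 2![apply: size_flatten_le => ? _].
Qed.

(** A preceding program may leave anything on stacks 2 to 24, so they are cleared first. The extra
    dummy and unit of the parameter provide the [+ 1] in [k ^ 2 + 1]. The output is built reversed,
    from the cell count to the threshold 1, and the last move onto stack 0 restores its order. *)
Definition reduction : cmd :=
  Seq (clear_list (iota 2 23))
 (Seq (read_nat 0 2 4) (Seq (move_ 0 5) (Seq push_dummy (Seq (Push 12 true) (Seq loop_i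
 (Seq (Push 11 false) (Seq out_matrix (Seq (push_word 11 (entry_word 8))
 (Seq (move_ 11 0) (Seq (clear 1) (move_ 12 1))))))))))).

Definition cells_bound M := M * (M * (M * M + 1)) + 1.
Definition code_bound M := cells_bound M * (4 * M + 4).
Definition row_bound M :=
  30 * M + 100 + 9 * code_bound M + (cells_bound M * (time_entry M).+1 + 1).
Definition matrix_bound M := 9 * code_bound M + 2 + (cells_bound M * (row_bound M).+1 + 1).
Definition reduction_bound M :=
  100 * M + time_i M + matrix_bound M + 5 * size (entry_word 8)
  + 4 * (cells_bound M * (cells_bound M * entry_cost)) + 4 * cells_bound M + 4 * (M * M) + 200.

Lemma clear_input (l : seq (seq bool)) :
  mkseq (fun i => if i \in iota 2 23 then [::] else nth [::] l i) 25 =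
  [:: nth [::] l 0, nth [::] l 1 & nseq 23 [::]].
Proof. by []. Qed.

Lemma runs_reduction ok k n l S :
  size l = 25 -> all (fun v => size v <= S) l ->
  nth [::] l 0 = enc_nat n ++ all_bits ok k n -> nth [::] l 1 = unary k ->
  runs l reduction (reduction_bound S.+1)
    [:: enc_nat (size (cells ok k n)) ++ matrix_word (cells ok k n) ++ entry_word 8;
        unary (k ^ 2).+1].
Proof.
move=> sl lS l0 l1; set cs := cells ok k n; set M := S.+1.
have s0 : size (enc_nat n ++ all_bits ok k n) <= S.
  by rewrite -l0; move/allP: lS; apply; rewrite mem_nth // sl.
have kM : k < M.
  by rewrite ltnS -(size_nseq k true) -/(unary k) -l1; move/allP: lS; apply; rewrite mem_nth // sl.
rewrite size_cat size_enc_nat in s0.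
have nM : n <= M by rewrite /M; lia.
have csM : all (small M) cs by exact: cells_small.
have csB : size cs <= cells_bound M.
  apply: leq_trans (size_cells_le _ _ _) _.
  by rewrite leq_add2r leq_mul ?(ltnW kM) // leq_mul ?(ltnW kM) // leq_add2r leq_mul.
have cdB : size (enc_cells cs) <= code_bound M.
  by apply: leq_trans (size_enc_cells csM) _; rewrite leq_mul2r csB orbT.
have rowB : time_row M cs <= row_bound M.
  by rewrite /time_row /row_bound leq_add ?leq_add2l ?leq_mul // leq_add2r leq_mul.
have matB : time_matrix M cs <= matrix_bound M.
  by rewrite /time_matrix /matrix_bound !leq_add ?leq_mul ?ltnS.
have mwB : size (matrix_word cs) <= cells_bound M * (cells_bound M * entry_cost).
  by apply: leq_trans (size_matrix_word _) _; rewrite !leq_mul.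
have kk : k * k <= M * M by rewrite leq_mul // ltnW.
eapply runs_le.
  eapply runs_seq; first by apply: (runs_clear_list (S := S)); rewrite ?sl.
  rewrite sl clear_input l0 l1; cbn [nseq ncons iter].
  step (runs_read_nat (m := n) (w := all_bits ok k n)).
  step runs_move.
  eapply runs_seq; first
    exact: (@runs_push_dummy k n 0 0 0 0 (rev (all_bits ok k n)) [::] 0 [::] [::] [::]).
  rewrite {1}/gen_state; step runs_push.
  eapply runs_seq; first exact: (@runs_loop_i ok k n M (ltnW kM) nM [:: dummy k] 1).
  rewrite -/(cells ok k n) -/cs {1}/gen_state; step runs_push.
  eapply runs_seq; first exact: (@runs_out_matrix k n (k * k + 1) M cs csM).
  rewrite {1}/out_state; step runs_push_word. step runs_move. step runs_clear.
  eapply runs_nth; first by eapply runs_move; side.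
    by [].
  case=> [|[|//]] _; cbn [nth set_nth].
    move: (entry_word 8) (matrix_word cs) (size cs) => w m N.
    by rewrite !rev_cat !revK rev_cons rev_unary -catA.
  by rewrite rev_unary cats0 addn1 expnS expn1.
cbn [nth]; rewrite /reduction_bound.
move: (entry_word 8) (matrix_word cs) mwB => w8 m mwB.
have MS : M = S.+1 by [].
clearbody cs M; rewrite !size_cat !size_rev /= !size_nseq.
move: (cells_bound M) (cells_bound M * _) (time_i M) (time_matrix _ _) (matrix_bound M)
  (k * k) (M * M) (size (all_bits _ _ _)) (size cs) (size m) (size w8)
  mwB csB matB kk s0 => cb e2 ti tm bm k2 M2 ab sc sm s8 mwB csB matB kk s0.
by lia.
Qed.

(** * Running times *)

(** A step adds at most one bit to a stack, so the time of one program bounds the input size of the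
    next. *)
Lemma size_exec c s t s' : exec c s t s' -> forall i, size (s' i) <= size (s i) + t.
Proof.
elim=> {c s t s'} [s|x b s|x s|c1 c2 s1 s2 s3 t1 t2 _ IH1 _ IH2|x c0 cf ct s t s' _ IH
  |x c s _|x c s1 s2 s3 t1 t2 _ _ IH1 _ IH2] i.
- by rewrite leq_addr.
- by rewrite /upd; case: eqP => [->|_] /=; lia.
- by rewrite /upd; case: eqP => [->|_] /=; rewrite ?size_behead; lia.
- by apply: leq_trans (IH2 i) _; rewrite addnA leq_add2r.
- by apply: leq_trans (IH i) _; rewrite leq_add2l.
- by rewrite leq_addr.
- by apply: leq_trans (IH2 i) _; have := IH1 i; lia.
Qed.

(** The base [n.+1] is positive, so exponents can be raised when two bounds are added. *)
Definition poly_bounded (f : nat -> nat) : Prop :=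
  exists C d, forall n, f n <= C * n.+1 ^ d.

Lemma poly_bounded_const c : poly_bounded (fun=> c).
Proof. by exists c, 0 => n; rewrite muln1. Qed.

Lemma poly_bounded_id : poly_bounded id.
Proof. by exists 1, 1 => n; rewrite mul1n expn1. Qed.

Lemma poly_boundedD f g : poly_bounded f -> poly_bounded g -> poly_bounded (fun n => f n + g n).
Proof.
move=> [C [d hf]] [C' [d' hg]]; exists (C + C'), (d + d') => n; rewrite mulnDl.
by rewrite leq_add // (leq_trans (hf n), leq_trans (hg n)) //
  leq_mul2l leq_pexp2l ?leq_addr ?leq_addl ?orbT.
Qed.

Lemma poly_boundedS f : poly_bounded f -> poly_bounded (fun n => (f n).+1).
Proof.
move=> /poly_boundedD/(_ (poly_bounded_const 1))[C [d h]]; exists C, d => n.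
by rewrite -addn1.
Qed.

Lemma poly_boundedM f g : poly_bounded f -> poly_bounded g -> poly_bounded (fun n => f n * g n).
Proof.
move=> [C [d hf]] [C' [d' hg]]; exists (C * C'), (d + d') => n.
by rewrite expnD mulnACA leq_mul.
Qed.

Lemma poly_bounded_reduction : poly_bounded (fun S => reduction_bound S.+1).
Proof.
rewrite /reduction_bound /matrix_bound /row_bound /code_bound /cells_bound /time_i /time_j
  /time_slot /time_a /time_b /time_entry.
by repeat match goal with
| |- poly_bounded (fun=> ?c) => exact: (poly_bounded_const c)
| |- poly_bounded (fun n => n) => exact: poly_bounded_id
| |- poly_bounded (fun n => (@?f n).+1) => apply: (@poly_boundedS f)
| |- poly_bounded (fun n => addn (@?f n) (@?g n)) => apply: (@poly_boundedD f g)
| |- poly_bounded (fun n => muln (@?f n) (@?g n)) => apply: (@poly_boundedM f g)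
end.
Qed.

(** Both the time factor and the parameter bound of the composed reduction have the form
    [C * (f k).+1 ^ e] and must be computable; each of the [e] rounds is a multiplication by
    repeated copying. *)
Definition power_cmd (C e : nat) : cmd :=
  Seq (clear 1) (Seq (clear 2) (Seq (clear 3) (Seq (Push 0 true)
 (Seq (push_word 1 (unary C))
 (Seq (iter e (Seq (Seq (for_ 1 (copy 0 2 3)) (move_ 2 1))) Skip)
 (Seq (clear 0) (move_ 1 0))))))).

Lemma runs_power C e m u v w : exists T, runs [:: unary m; u; v; w] (power_cmd C e) T
  [:: unary (C * m.+1 ^ e)].
Proof.
have mul a : exists T, runs [:: unary m.+1; unary a; [::]; [::]]
    (Seq (for_ 1 (copy 0 2 3)) (move_ 2 1)) T
    [:: unary m.+1; unary (a * m.+1); [::]; [::]].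
  eexists; eapply runs_seq.
    have := @runs_for (fun i => [:: unary m.+1; unary i; unary ((a - i) * m.+1); [::]])
      1 (copy 0 2 3) (9 * m.+1 + 2) a.
    rewrite subnn mul0n; apply=> // i ia; split=> //; cbn [set_nth].
    eapply runs_post; first by eapply runs_le; [eapply runs_copy; side | rewrite /= size_nseq].
    cbn [set_nth nth]; rewrite /unary -nseqD (_ : a - i = (a - i.+1).+1) ?mulSn //.
    by lia.
  by final runs_move; rewrite rev_unary subn0.
have pow : exists T, runs [:: unary m.+1; unary C; [::]; [::]]
    (iter e (Seq (Seq (for_ 1 (copy 0 2 3)) (move_ 2 1))) Skip) T
    [:: unary m.+1; unary (C * m.+1 ^ e); [::]; [::]].
  elim: e C => [|e IH] D /=; first by exists 1; rewrite muln1; exact: runs_skip.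
  have [T1 h1] := mul D; have [T2 h2] := IH (D * m.+1).
  exists (T1 + T2); apply: runs_seq h1 _; rewrite expnS mulnA; exact: h2.
have [T h] := pow; eexists; rewrite /power_cmd.
step runs_clear. step runs_clear. step runs_clear. step runs_push. step runs_push_word.
rewrite rev_unary; eapply runs_seq; first exact: h.
step runs_clear; eapply runs_nth; first by eapply runs_move; side.
  by [].
by case=> [|//] _; cbn [nth set_nth]; rewrite rev_unary cats0.
Qed.

Lemma computable_power f C e : computable f -> computable (fun k => C * (f k).+1 ^ e).
Proof.
move=> [c hc]; exists (Seq c (power_cmd C e)) => k.
have [t [s [ex s0]]] := hc k.
have [T h] := runs_power C e (f k) (s 1) (s 2) (s 3).
have [|t' [s' [ex' _ hs]]] := h s; first by case=> [|[|[|[|]]]].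
by exists (t + t'), s'; split; [exact: ExecSeq ex ex' | rewrite hs].
Qed.

(** * The encoded instance as a stream of relation bits *)

Section Encoding.
Variables (k n : nat) (I : bcsp k n).

(** Cells and programs work with natural numbers, so the relations are extended by [false] outside
    the index ranges. *)
Definition rel_bit (i j a b : nat) : bool :=
  if (insub i : option 'I_k, insub j : option 'I_k, insub a : option 'I_n, insub b : option 'I_n)
  is (Some i', Some j', Some a', Some b') then (a', b') \in con I i' j' else false.

Lemma rel_bitE (i j : 'I_k) (a b : 'I_n) : rel_bit i j a b = ((a, b) \in con I i j).
Proof. by rewrite /rel_bit !valK. Qed.

Lemma upto_enum T m (f : nat -> seq T) : upto f m = flatten [seq f i | i : 'I_m].
Proof. by rewrite /upto -val_enum_ord -map_comp. Qed.

Lemma flatten_flatten T (s : seq (seq (seq T))) :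
  flatten (flatten s) = flatten [seq flatten x | x <- s].
Proof. by elim: s => //= x s IH; rewrite flatten_cat IH. Qed.

(** Filtering the pairs [i < j], as the encoding does, amounts to giving the other pairs an empty
    word, as [bit] does. *)
Lemma enc_bcspE : enc_bcsp I = enc_nat n ++ all_bits rel_bit k n.
Proof.
congr cat; rewrite flatten_flatten -map_comp /all_bits upto_enum; congr flatten.
apply: eq_map => i /=; rewrite upto_enum.
have -> (s : seq 'I_k) (f : 'I_k -> seq bool) (P : pred 'I_k) :
    flatten [seq f j | j <- s & P j] = flatten [seq if P j then f j else [::] | j <- s].
  by elim: s => //= j s IH; case: (P j); rewrite /= IH.
congr flatten; apply: eq_map => j; rewrite /bit; case: ifP => ij; last first.
  have nil m : upto (fun=> [::] : seq bool) m = [::] by rewrite /upto; elim: (iota 0 m).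
  by rewrite [RHS]/upto; under eq_map => a do rewrite nil; rewrite -[LHS](nil n).
rewrite upto_enum; congr flatten; apply: eq_map => a; rewrite upto_enum flatten_map1.
by apply: eq_map => b; rewrite rel_bitE.
Qed.

End Encoding.

(** * The reduction *)

Local Open Scope ring_scope.

Lemma pow_63_64 (R : realType) (m : nat) : (63 / 64) ^+ m <= 2 `^ (- (m%:R / 64)) :> R.
Proof.
(* Six squarings, with the value rounded up to a short decimal after each of the first five. *)
have h64 : (63 / 64) ^+ 64 <= 2^-1 :> R.
  have sq (x y z : R) : 0 <= x -> x <= y -> y ^+ 2 <= z -> x ^+ 2 <= z.
    by move=> x0 xy; apply: le_trans; rewrite lerXn2r ?nnegrE ?(le_trans x0).
  rewrite (_ : 64 = 2 * (2 * (2 * (2 * (2 * 2)))))%N // !exprM.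
  apply: (sq _ (62 / 100)); [by do ?apply: exprn_ge0; lra| |lra].
  apply: (sq _ (787 / 1000)); [by do ?apply: exprn_ge0; lra| |lra].
  apply: (sq _ (887 / 1000)); [by do ?apply: exprn_ge0; lra| |lra].
  apply: (sq _ (9415 / 10000)); [by do ?apply: exprn_ge0; lra| |lra].
  by apply: (sq _ (9702 / 10000)); lra.
rewrite -(ler_pXn2r (n := 64)) ?nnegrE ?exprn_ge0 ?powR_ge0 //; last lra.
rewrite -[leRHS]powR_mulrn ?powR_ge0 // -powRrM.
rewrite (_ : - (m%:R / 64) * 64%:R = - m%:R :> R); last by field.
rewrite powRN powR_mulrn // -exprVn -!exprM mulnC exprM.
by rewrite lerXn2r ?nnegrE ?exprn_ge0 ?invr_ge0 //; lra.
Qed.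

(** Here 2048 is 64 * 8 * 4: 64 comes from [pow_63_64], 8 from the hypothesis, a factor 2 from
    bounding the root by [2 * k], and the last 2 makes the inequality strict. *)
Lemma gap_bound (R : realType) (eps : R) (k m : nat) : 0 < eps -> (0 < k)%N ->
  eps * k%:R <= 8 * m%:R ->
  (63 / 64) ^+ m < 2 `^ (- (eps / 2048 * Num.sqrt (k ^ 2).+1%:R)) :> R.
Proof.
move=> e0 k0 h; apply: le_lt_trans (pow_63_64 R m) _.
suff : eps / 2048 * Num.sqrt (k ^ 2).+1%:R < m%:R / 64.
  by rewrite /powR pnatr_eq0 /= ltr_expR ltr_pM2r ?ln_gt0 ?ltr1n // ltrN2.
have k1 : 1 <= k%:R :> R by rewrite ler1n.
have s2 : Num.sqrt (k ^ 2).+1%:R <= 2 * k%:R :> R.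
  rewrite -[leRHS]ger0_norm ?mulr_ge0 // -sqrtr_sqr ler_wsqrtr //.
  by rewrite -natr1 natrX; nra.
nra.
Qed.

(** Cancelling [k] leaves [eps * (k - 1) <= 4 * m], and [k <= 2 * (k - 1)] for [k] at least 2. *)
Lemma bin2_gap (R : realType) (eps : R) (k m : nat) : 0 < eps -> (1 < k)%N ->
  eps * 'C(k, 2)%:R <= (2 * k * m)%:R -> eps * k%:R <= 8 * m%:R.
Proof.
move=> e0 k1 h.
have k2 : 2 <= k%:R :> R by rewrite (ler_nat R 2).
have eC : 'C(k, 2)%:R * 2 = k%:R * (k%:R - 1) :> R.
  case: (k) k1 => // j _; rewrite -natrM mulnC -mul_bin_diag bin1 natrM.
  by rewrite (_ : j.+1%:R - 1 = j%:R) // -natr1 addrK.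
rewrite !natrM in h.
have km : eps * (k%:R - 1) <= 4 * m%:R :> R by nra.
nra.
Qed.

Lemma flatten_nth (T : Type) (A : Type) (x0 : A) (s : seq A) (f : A -> seq T) :
  flatten [seq f (nth x0 s u) | u : 'I_(size s)] = flatten [seq f x | x <- s].
Proof.
by rewrite -[s in RHS](mkseq_nth x0) /mkseq -val_enum_ord -2!map_comp.
Qed.

(** * The matrix of an instance and its two cases *)

Section Instance.
Variables (k n : nat) (I : bcsp k n).
Let ok := rel_bit I.
Let cs := cells ok k n.
Let f (u : 'I_(size cs)) : cell := nth (dummy k) cs u.

Definition instance_matrix : 'M[rat]_(size cs) := gram rat f.

Lemma instance_code :
  enc_nat (size cs) ++ matrix_word cs ++ entry_word 8 = enc_detmax instance_matrix 1.
Proof.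
have -> : entry_word 8 = enc_rat 1 by rewrite /entry_word divff // pnatr_eq0.
rewrite /enc_detmax; congr (_ ++ (_ ++ _)).
rewrite /matrix_word -(flatten_nth (dummy k) cs) flatten_flatten -map_comp.
congr flatten; apply: eq_map => u /=.
rewrite /row_word -(flatten_nth (dummy k) cs); congr flatten.
by apply: eq_map => v /=; rewrite mxE.
Qed.

(** Real vectors are to be tested, so the Gram argument is applied over [R] to the image of the
    matrix. *)
Lemma instance_psd (R : realType) : psd R instance_matrix.
Proof.
have [sym _] := gram_psd rat f; split=> // v.
have -> : map_mx (@ratr R) instance_matrix = gram R f.
  by apply/matrixP=> u w; rewrite !mxE rmorphM /= fmorphV /= !ratr_nat.
exact: (gram_psd R f).2.
Qed.

Lemma instance_diagonal : unit_diagonal instance_matrix.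
Proof. by move=> u; rewrite mxE ipxx divff // pnatr_eq0. Qed.

Lemma instance_size : (0 < (k ^ 2).+1 <= size cs)%N.
Proof. exact: size_cells. Qed.

Lemma principal_gram (S : {set 'I_(size cs)}) :
  principal instance_matrix S = gram rat (fun p => f (enum_val p)).
Proof. by apply/matrixP=> p q; rewrite !mxE. Qed.

Lemma instance_yes : satisfiable I -> 1 <= maxdet instance_matrix (k ^ 2).+1.
Proof.
move=> /(satisfiable_orthogonal (rel_bitE I))[S [cardS S0]].
rewrite /maxdet; apply: (@Order.TotalTheory.bigmax_sup _ _ _ _ S); first by rewrite cardS.
rewrite principal_gram (_ : gram _ _ = 1%:M) ?det1 //.
apply/matrixP=> p q; rewrite !mxE; have [->|pq] := eqVneq p q.
  by rewrite ipxx divff // pnatr_eq0.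
rewrite S0 ?enum_valP ?mul0r //.
by apply: contra pq => /eqP/enum_val_inj->.
Qed.

Lemma instance_no (R : realType) (eps : R) : 0 < eps < 1 ->
  (forall psi, eps <= (violated I psi)%:R / 'C(k, 2)%:R) ->
  ratr (maxdet instance_matrix (k ^ 2).+1) <
    2 `^ (- (eps / 2048 * Num.sqrt (k ^ 2).+1%:R)) :> R.
Proof.
move=> /andP[e0 e1] hv; rewrite /maxdet.
(* For k <= 1 there are no constraints and 0 / 0 = 0, so an assignment would give
   eps <= 0. *)
have no_psi : (k <= 1)%N -> ('I_k -> 'I_n) -> False.
  move=> k1 psi; have := hv psi; rewrite bin_small // mulr0n invr0 mulr0.
  by rewrite leNgt e0.
have k0 : (0 < k)%N.
  by case: (posnP k) => // k0; case: no_psi; rewrite k0 // => -[].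
(* The bound passes to maxima and holds for the default 0, so one principal minor remains. *)
elim/big_ind: _ => [|x y hx hy|S /eqP cardS]; first by rewrite rmorph0 powR_gt0.
  by rewrite /Order.max; case: ifP.
have [F [F0 /andP[_ det_le]]] := gram_det rat (fun p => f (@enum_val _ (mem S) p)).
rewrite principal_gram.
apply: (@le_lt_trans _ _ ((63 / 64) ^+ (#|S| - #|F|))).
  have -> : (63 / 64) ^+ (#|S| - #|F|) = ratr ((63 / 64) ^+ (#|S| - #|F|)) :> R.
    by rewrite rmorphXn /= fmorph_div /= !ratr_nat.
  by rewrite ler_rat.
have -> : (#|S| - #|F| = (k ^ 2).+1 - #|F|)%N by congr (_ - _)%N.
apply: gap_bound => //.
have hin p : f (@enum_val _ (mem S) p) \in cs by rewrite mem_nth.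
(* With an empty alphabet there is no assignment to use. All cells are then dummies, so [F] has at
   most one element, and [eps < 1] suffices. *)
have [n0|n0] := posnP n.
  have F1 : (#|F| <= 1)%N.
    apply/card_le1_eqP => p q pF qF; apply/eqP/negPn/negP => /(F0 q p qF pF).
    have d r : f (@enum_val _ (mem S) r) = dummy k.
      apply/eqP/negPn/negP => /(mem_cells (hin r))[i [j [a [b [[_ _ _ + _] _]]]]].
      by rewrite n0.
    by rewrite !d ipxx.
  apply: (@le_trans _ _ k%:R); first by rewrite ler_piMl // ltW.
  by rewrite -natrM ler_nat; nia.
have k1 : (1 < k)%N by rewrite ltnNge; apply/negP => /no_psi; apply=> _; exact: Ordinal n0.
have [psi le] := orthogonal_violated (rel_bitE I) hin F0 n0.
apply: bin2_gap => //; apply: (@le_trans _ _ (violated I psi)%:R); last by rewrite ler_nat.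
by rewrite -ler_pdivlMr // ltr0n bin_gt0.
Qed.

End Instance.

(** With [P] the input size plus one, [W] dominates both [P] and the first running time, so the
    total is at most [C.+1 * W ^ e.+1]. *)
Lemma reduction_time (C e d f P t : nat) : (0 < P)%N -> (t <= f * P ^ d)%N ->
  (t + C * (P + t) ^ e <= C.+1 * f.+1 ^ e.+1 * P ^ (d.+1 * e.+1))%N.
Proof.
move=> P0 tf; pose W := (f.+1 * P ^ d.+1)%N.
have tW : (t <= f * P ^ d.+1)%N.
  by apply: leq_trans tf _; rewrite leq_mul2l leq_pexp2l ?orbT.
have PW : (P <= P ^ d.+1)%N by rewrite -[leqLHS]expn1 leq_pexp2l.
have St : (P + t <= W)%N by rewrite /W mulSn leq_add.
have W0 : (0 < W)%N by rewrite muln_gt0 expn_gt0 P0.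
rewrite expnM -mulnA -expnMn -/W mulSn leq_add //.
  by apply: leq_trans (leq_addl _ _) _; apply: leq_trans St _; rewrite -[leqLHS]expn1 leq_pexp2l.
rewrite leq_mul2l; apply/orP; right; apply: (@leq_trans (W ^ e)).
  by case: (posnP e) => [->//|e0]; rewrite leq_exp2r.
by rewrite leq_pexp2l.
Qed.

(** Since [D] may be any property implied by a unit diagonal, one composed reduction serves both
    claims. *)
Lemma gap_bcsp_reduces (R : realType) (eps : R) (L : param_language)
    (D : forall n, 'M[rat]_n -> Prop) :
  0 < eps < 1 -> (forall n (A : 'M[rat]_n), unit_diagonal A -> D n A) ->
  fpt_reduces L (gap_bcsp eps) ->
  fpt_reduces L (gap_detmax (fun k : nat => 2 `^ (- (eps / 2048 * Num.sqrt k%:R)) : R) D).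
Proof.
move=> eps01 diagD [c [f [g [d [cf cg red]]]]].
have [C [e timeC]] := poly_bounded_reduction.
(* Time factor and exponent are those of [reduction_time]; the new parameter [k1 ^ 2 + 1] is at most
   [(g k).+1 ^ 2]. *)
exists (Seq c reduction), (fun k => (C.+1 * (f k).+1 ^ e.+1)%N),
  (fun k => (1 * (g k).+1 ^ 2)%N), (d.+1 * e.+1)%N.
split; [exact: computable_power | exact: computable_power |] => x k.
have [t [s [k1 [ex tle s1 k1g [Lyes Lno]]]]] := red x k.
(* Yes- and no-instances are both encoded instances, so a single [I] can be fixed for the two
   cases. *)
have [n [I [s0 sat unsat]]] : exists n (I : bcsp k1 n), [/\ s 0%N = enc_bcsp I,
    L x k -> satisfiable I &
    ~ L x k -> forall psi, eps <= (violated I psi)%:R / 'C(k1, 2)%:R].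
  have [Lx|Lx] := pselect (L x k).
    by have [n [I [e0 h]]] := Lyes Lx; exists n, I; split.
  by have [n [I [e0 h]]] := Lno Lx; exists n, I; split.
pose S := (size x + k + t)%N.
have szS i : (size (s i) <= S)%N.
  apply: leq_trans (size_exec ex i) _; rewrite leq_add2r.
  by rewrite /init; case: i => [|[|i]] /=; rewrite ?size_nseq ?nth_nil ?leq_addr ?leq_addl.
have [|||||t' [s' [ex' tle' hs']]] :=
    @runs_reduction (rel_bit I) k1 n (mkseq s 25) S _ _ _ _ s.
- by rewrite size_mkseq.
- by apply/(all_nthP [::]) => i; rewrite size_mkseq => i25; rewrite nth_mkseq.
- by rewrite nth_mkseq // s0 enc_bcspE.
- by rewrite nth_mkseq.
- by move=> i; rewrite size_mkseq => i25; rewrite nth_mkseq.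
exists (t + t')%N, s', (k1 ^ 2).+1; split.
- exact: ExecSeq ex ex'.
- apply: leq_trans (reduction_time C e _ tle); last by rewrite addn1.
  rewrite leq_add2l (leq_trans tle') // (leq_trans (timeC S)) //.
  by rewrite (_ : S.+1 = size x + k + 1 + t)%N // /S; lia.
- by rewrite hs'.
- by rewrite mul1n; move: k1g; rewrite -(leq_exp2r _ _ (isT : 0 < 2)%N); lia.
have -> : s' 0%N = enc_detmax (instance_matrix I) 1 by rewrite hs' //= instance_code.
have inst : [/\ enc_detmax (instance_matrix I) 1 = enc_detmax (instance_matrix I) 1,
    psd R (instance_matrix I), D _ (instance_matrix I),
    (0 < (k1 ^ 2).+1 <= size (cells (rel_bit I) k1 n))%N & 0 < 1 :> rat].
  by split=> //; [exact: instance_psd | exact/diagD/instance_diagonal | exact: instance_size].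
split=> Lx; exists (size (cells (rel_bit I) k1 n)), (instance_matrix I), 1; split=> //.
  exact/instance_yes/sat.
by rewrite rmorph1 mulr1; exact: instance_no (unsat Lx).
Qed.

Theorem theorem5p1 (R : realType) :
  PIH R ->
  exists c : R, 0 < c /\
    W1_hard_to_approximate_detmax
      (fun k : nat => 2 `^ (- (c * Num.sqrt k%:R))) (fun _ _ => True) /\
    W1_hard_to_approximate_detmax
      (fun k : nat => 2 `^ (- (c * Num.sqrt k%:R))) unit_diagonal.
Proof.
move=> [eps [eps01 hard]]; exists (eps / 2048); split.
  by case/andP: eps01 => e0 _; rewrite divr_gt0.
by split=> L /hard; apply: gap_bcsp_reduces.
Qed.
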